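(* Let $1\le p<\infty$ and $n\in\mathbb N$. Let $g$ be analytic in $\mathbb D$ such that $T_{g,1}:H^p\to H^p$ is bounded. Then $$\|T_{g,n}\|_{H^p\to H^p}\le C_n\,\|T_{g,1}\|_{H^p\to H^p},\qquad\text{where}\qquad C_n:=\frac1{(n-1)!}.$$ Moreover, the constant $C_n=1/(n-1)!$ is optimal among all bounds obtained via the factorization $T_{g,n}=V^{n-1}\circ T_{g,1}$ and submultiplicativity of operator norms.
   Context: $\mathbb D=\{z\in\mathbb C:|z|<1\}$. For $1\le p<\infty$, $H^p$ is the Hardy space of analytic functions $f$ in $\mathbb D$ with $\|f\|_{H^p}=\sup_{0<r<1}\left(\frac1{2\pi}\int_0^{2\pi}|f(re^{i\theta})|^p\,d\theta\right)^{1/p}<\infty$, and $\|\cdot\|_{H^p\to H^p}$ denotes the operator norm. For analytic $f,g$ in $\mathbb D$ and $n\in\mathbb N=\{1,2,\dots\}$, $$T_{g,n}[f](z)=\int_0^z\int_0^{t_1}\cdots\int_0^{t_{n-1}} f(t_n)g'(t_n)\,dt_n\cdots dt_1,\quad z\in\mathbb D,$$ an $n$-fold iterated integral, equivalently $T_{g,n}[f](z)=\frac1{(n-1)!}\int_0^z(z-t)^{n-1}f(t)g'(t)\,dt$; in particular $T_{g,1}[f](z)=\int_0^zf(t)g'(t)\,dt$. The integration operator is $V\varphi(z)=\int_0^z\varphi(t)\,dt$, and $V^k$ denotes its $k$-fold iterate ($V^0$ being the identity). *)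

(* Defs.v *)
From Stdlib Require Import Reals.
From Coquelicot Require Export Coquelicot.
Open Scope R_scope.

(* Functions on the disc are total functions C -> C; every notion below only
   looks at their values on the disc. *)
Definition unit_disc (z : C) : Prop := Cmod z < 1.

Definition analytic_disc (f : C -> C) : Prop :=
  forall z0 : C, unit_disc z0 ->
    exists (a : nat -> C) (rho : R), 0 < rho /\
      forall z : C, Cmod (z - z0)%C < rho ->
        @is_pseries C_AbsRing C_NormedModule a (z - z0)%C (f z).

(* x ^ p for x >= 0 and p > 0. [Rpower] alone would give 0 ^ p = 1. *)
Definition rpow (x p : R) : R :=
  if Rle_dec x 0 then 0 else Rpower x p.

Definition circle_mean (p : R) (f : C -> C) (r : R) : R :=
  rpow (/ (2 * PI) *
        RInt (fun theta => rpow (Cmod (f (r * cos theta, r * sin theta))) p)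
             0 (2 * PI))
       (/ p).

(* Valued in [Rbar]: it is [p_infty] when the supremum is infinite. *)
Definition Hp_norm (p : R) (f : C -> C) : Rbar :=
  Lub_Rbar (fun x => exists r : R, 0 < r < 1 /\ x = circle_mean p f r).

Definition Hp (p : R) (f : C -> C) : Prop :=
  analytic_disc f /\ Rbar_lt (Hp_norm p f) p_infty.

Definition bounded_Hp (p : R) (T : (C -> C) -> (C -> C)) : Prop :=
  (forall f, Hp p f -> Hp p (T f)) /\
  exists M : R, forall f, Hp p f ->
    Rbar_le (Hp_norm p (T f)) (Rbar_mult M (Hp_norm p f)).

(* sup of ||T f|| over the unit ball of H^p. [Lub_Rbar] takes a set of reals
   while ||T f|| lies in [Rbar], so the set is closed downwards; this does not
   change the supremum and keeps track of infinite values. *)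
Definition Hp_opnorm (p : R) (T : (C -> C) -> (C -> C)) : Rbar :=
  Lub_Rbar (fun x => exists f, Hp p f /\ Rbar_le (Hp_norm p f) 1 /\
                               Rbar_le x (Hp_norm p (T f))).

(* Integral from 0 to z along the segment t = s z, 0 <= s <= 1. *)
Definition V (phi : C -> C) (z : C) : C :=
  (z * @RInt C_R_CompleteNormedModule (fun s : R => phi (RtoC s * z)%C) 0 1)%C.

Definition Vpow (k : nat) (phi : C -> C) : C -> C := Nat.iter k V phi.

(* The n-fold iterated integral of f g'. *)
Definition Tgn (g : C -> C) (n : nat) (f : C -> C) : C -> C :=
  Nat.iter n V (fun t => (f t * C_derive g t)%C).

(* [c] is a constant for which submultiplicativity applied to
   T_{g,n} = V^{n-1} o T_{g,1} gives ||T_{g,n}|| <= c ||T_{g,1}||.  Splitting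
   V^{n-1} further and bounding ||V^{n-1}|| by the product of the norms of the
   factors also yields such a [c]. *)
Definition factorization_constant (p : R) (n : nat) (c : R) : Prop :=
  bounded_Hp p (Vpow (n - 1)) /\ Rbar_le (Hp_opnorm p (Vpow (n - 1))) c.

(* Main.v *)
Require Import Defs.
From Stdlib Require Import Reals Factorial.
From Stdlib Require Import Lra Lia Classical ClassicalEpsilon FunctionalExtensionality.
From Coquelicot Require Import Coquelicot.
Open Scope R_scope.

(** Since [Tgn g n f] is [V] iterated [n - 1] times on [Tgn g 1 f], everything
    reduces to the operator norm of the powers of [V], which is exactly [1 / k!]
    for [Vpow k].

    Upper bound.  Write [M_p(r, f)] for [circle_mean p f r].  Since
    [V f (z)] is the integral of [z f(s z)] over [0 <= s <= 1], Minkowski's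
    integral inequality gives [M_p(r, V f) <= r * int_0^1 M_p(s r, f) ds].
    Hence a bound [M_p(r, f) <= A r^m] for all [r < 1] improves to
    [M_p(r, V f) <= A r^(m+1) / (m+1)] (lemma [pmean_le_V]); starting from
    [A = ||f||] and [m = 0], induction yields
    [M_p(r, V^k f) <= ||f|| r^k / k!] (lemma [pmean_le_Vpow]).  Keeping the
    power of [r] is what produces the factorial: the estimate [||V|| <= 1] alone
    only gives [||V^k|| <= 1].  Minkowski's inequality is obtained for finite
    sums from the convexity of [x^p] (lemma [pmean_le_plus]) and applied to
    right Riemann sums, which dominate [|V f|] up to an arbitrarily small error,
    uniformly on the circle (lemma [riemann_sum_ge]).  In this way no exchange
    of two integrals is needed.

    Lower bound.  [V^k 1 = z^k / k!] has mean [r^k / k!] on the circle of radius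
    [r], and the supremum over [r < 1] is [1 / k!] (lemma [Hp_norm_Vpow_one]).

    It remains to see that [V f] is analytic when [f] is (lemma [analytic_V]).
    Each local power series of [f] integrates termwise to a local primitive [G]
    (lemma [local_primitive]).  For [w] close to [z0], the integral of [f] around
    the triangle with vertices [0], [z0], [w] vanishes: the integral around the
    shrunk triangle [0], [t z0], [t w] is locally constant in [t], with a uniform
    step by compactness of the segment from [0] to [z0]
    (lemma [path_int_triangle]).  So [V f] differs from [G] by a constant near
    [z0]. *)

(** * Powers with a real exponent *)

Lemma rpow_ge_0 x p : 0 <= rpow x p.
Proof.
  unfold rpow; destruct (Rle_dec x 0); [lra|]. apply Rlt_le, exp_pos.
Qed.

Lemma rpow_0_l p : rpow 0 p = 0.
Proof. unfold rpow; destruct (Rle_dec 0 0); lra. Qed.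

Lemma rpow_pos_eq x p : 0 < x -> rpow x p = Rpower x p.
Proof. intros; unfold rpow; destruct (Rle_dec x 0); [lra|reflexivity]. Qed.

Lemma rpow_gt_0 x p : 0 < x -> 0 < rpow x p.
Proof. intros; rewrite rpow_pos_eq by lra; apply exp_pos. Qed.

Lemma rpow_le x y p : 0 <= p -> x <= y -> rpow x p <= rpow y p.
Proof.
  intros Hp Hxy.
  destruct (Rle_dec x 0) as [Hx|Hx].
  - unfold rpow at 1. destruct (Rle_dec x 0); [|lra]. apply rpow_ge_0.
  - rewrite !rpow_pos_eq by lra. apply Rle_Rpower_l; lra.
Qed.

Lemma rpow_mult x y p : 0 <= x -> 0 <= y -> rpow (x * y) p = rpow x p * rpow y p.
Proof.
  intros Hx Hy.
  destruct (Req_dec x 0) as [->|Hx']; [rewrite Rmult_0_l, rpow_0_l; ring|].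
  destruct (Req_dec y 0) as [->|Hy']; [rewrite Rmult_0_r, rpow_0_l; ring|].
  assert (0 < x * y) by (apply Rmult_lt_0_compat; lra).
  rewrite !rpow_pos_eq by lra. symmetry. apply Rpower_mult_distr; lra.
Qed.

Lemma rpow_inv_r x p : 0 < p -> 0 <= x -> rpow (rpow x p) (/ p) = x.
Proof.
  intros Hp Hx.
  destruct (Req_dec x 0) as [->|Hx']; [now rewrite !rpow_0_l|].
  rewrite (rpow_pos_eq (rpow x p)) by (apply rpow_gt_0; lra).
  rewrite rpow_pos_eq by lra.
  rewrite Rpower_mult, Rinv_r by lra. apply Rpower_1; lra.
Qed.

Lemma rpow_inv_l x p : 0 < p -> 0 <= x -> rpow (rpow x (/ p)) p = x.
Proof.
  intros Hp Hx. rewrite <- (Rinv_inv p) at 2.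
  apply rpow_inv_r; [apply Rinv_0_lt_compat|]; assumption.
Qed.

(** Bernoulli's inequality for real exponents.  For [t = exp y] it follows from
    [exp u >= 1 + u] at [u = (p - 1) y] and at [u = - y]. *)
Lemma rpow_bernoulli t p : 1 <= p -> 0 <= t -> 1 + p * (t - 1) <= rpow t p.
Proof.
  intros Hp Ht.
  destruct (Req_dec t 0) as [->|Ht']; [rewrite rpow_0_l; lra|].
  rewrite rpow_pos_eq by lra. unfold Rpower.
  set (y := ln t). assert (Ey : exp y = t) by (apply exp_ln; lra).
  rewrite <- Ey.
  assert (H1 : exp y * (1 + (p - 1) * y) <= exp (p * y)).
  { replace (p * y) with (y + (p - 1) * y) by ring. rewrite exp_plus.
    apply Rmult_le_compat_l; [apply Rlt_le, exp_pos|]. apply exp_ineq1_le. }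
  assert (H2 : exp y * (1 + - y) <= 1).
  { rewrite <- exp_0 at 2. replace 0 with (y + - y) by ring. rewrite exp_plus.
    apply Rmult_le_compat_l; [apply Rlt_le, exp_pos|]. apply exp_ineq1_le. }
  assert (H3 : (p - 1) * (exp y * (1 + - y)) <= (p - 1) * 1)
    by (apply Rmult_le_compat_l; lra).
  lra.
Qed.

Lemma rpow_tangent x y p : 1 <= p -> 0 <= x -> 0 < y ->
  rpow y p + p * (x - y) * (rpow y p / y) <= rpow x p.
Proof.
  intros Hp Hx Hy.
  replace x with (y * (x / y)) at 2 by (field; lra).
  assert (Hq : 0 <= x / y) by (apply Rdiv_le_0_compat; lra).
  rewrite rpow_mult by lra.
  replace (rpow y p + p * (x - y) * (rpow y p / y))
    with (rpow y p * (1 + p * (x / y - 1))) by (field; lra).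
  apply Rmult_le_compat_l; [apply rpow_ge_0|]. now apply rpow_bernoulli.
Qed.

Lemma rpow_convex x y l p : 1 <= p -> 0 <= x -> 0 <= y -> 0 <= l <= 1 ->
  rpow (l * x + (1 - l) * y) p <= l * rpow x p + (1 - l) * rpow y p.
Proof.
  intros Hp Hx Hy Hl.
  set (m := l * x + (1 - l) * y).
  assert (Hlx : 0 <= l * x) by (apply Rmult_le_pos; lra).
  assert (Hly : 0 <= (1 - l) * y) by (apply Rmult_le_pos; lra).
  destruct (Req_dec m 0) as [E|E].
  - rewrite E, rpow_0_l.
    apply Rplus_le_le_0_compat; apply Rmult_le_pos; try lra; apply rpow_ge_0.
  - assert (Hm : 0 < m) by (unfold m in *; lra).
    assert (H1 := Rmult_le_compat_l l _ _ (proj1 Hl) (rpow_tangent x m p Hp Hx Hm)).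
    assert (H2 := Rmult_le_compat_l (1 - l) _ _ ltac:(lra) (rpow_tangent y m p Hp Hy Hm)).
    assert (E2 : l * (rpow m p + p * (x - m) * (rpow m p / m)) +
            (1 - l) * (rpow m p + p * (y - m) * (rpow m p / m)) = rpow m p).
    { transitivity (rpow m p + p * (l * x + (1 - l) * y - m) * (rpow m p / m));
        [unfold Rdiv; ring|fold m; ring]. }
    lra.
Qed.

Lemma continuous_rpow x p : 0 < p -> continuous (fun t => rpow t p) x.
Proof.
  intros Hp.
  destruct (Rlt_dec x 0) as [Hx|Hx].
  { apply continuous_ext_loc with (fun _ => 0); [|apply continuous_const].
    exists (mkposreal (-x) ltac:(lra)). intros y Hy.
    change (Rabs (y - x) < - x) in Hy. apply Rabs_def2 in Hy.
    unfold rpow. destruct (Rle_dec y 0); [reflexivity|lra]. }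
  destruct (Rlt_dec 0 x) as [Hx'|Hx'].
  { apply continuous_ext_loc with (fun t => exp (p * ln t)).
    { exists (mkposreal x ltac:(lra)). intros y Hy.
      change (Rabs (y - x) < x) in Hy. apply Rabs_def2 in Hy.
      rewrite rpow_pos_eq by lra. reflexivity. }
    apply (ex_derive_continuous (V := R_NormedModule)). auto_derive. lra. }
  assert (x = 0) by lra. subst x. clear Hx Hx'.
  apply filterlim_locally. intros [e He]. rewrite rpow_0_l.
  assert (Hd : 0 < rpow e (/ p)) by now apply rpow_gt_0.
  exists (mkposreal _ Hd). intros y Hy.
  change (Rabs (y - 0) < rpow e (/ p)) in Hy. apply Rabs_def2 in Hy.
  change (Rabs (rpow y p - 0) < e). rewrite Rminus_0_r, Rabs_pos_eq by apply rpow_ge_0.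
  destruct (Rle_dec y 0) as [Hy0|Hy0].
  - unfold rpow. destruct (Rle_dec y 0); lra.
  - rewrite <- (rpow_inv_l e p) by lra.
    rewrite (rpow_pos_eq y), (rpow_pos_eq (rpow e (/ p))) by lra.
    apply Rlt_Rpower_l; lra.
Qed.

(** * Minkowski's inequality for means over the circle *)

(** [pmean_le p h B]: the function [h] is continuous, nonnegative, and its
    [L^p] norm for the normalised measure of the circle is at most [B]. *)
Definition pmean_le (p : R) (h : R -> R) (B : R) : Prop :=
  (forall t, continuous h t) /\ (forall t, 0 <= h t) /\
  RInt (fun t => rpow (h t) p) 0 (2 * PI) <= 2 * PI * rpow B p.

Lemma ex_RInt_rpow p h a b : 0 < p -> (forall t, continuous h t) ->
  ex_RInt (fun t => rpow (h t) p) a b.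
Proof.
  intros Hp Hh. apply (ex_RInt_continuous (V := R_CompleteNormedModule)).
  intros t _. apply (continuous_comp h (fun y => rpow y p)).
  - apply Hh.
  - now apply continuous_rpow.
Qed.

(** Minkowski's inequality: [f + g] is [A + B] times the convex combination of
    [f / A] and [g / B] with weights [A / (A + B)] and [B / (A + B)], to which
    convexity of [x^p] applies. *)
Lemma pmean_le_plus p f g A B : 1 <= p -> 0 < A -> 0 < B ->
  pmean_le p f A -> pmean_le p g B -> pmean_le p (fun t => f t + g t) (A + B).
Proof.
  intros Hp HA HB (cf & pf & If) (cg & pg & Ig).
  assert (cs : forall t, continuous (fun t => f t + g t) t)
    by (intros t; apply (continuous_plus (V := R_NormedModule)); auto).
  assert (HPI := PI_RGT_0).
  split; [exact cs|split; [intros t; specialize (pf t); specialize (pg t); lra|]].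
  set (l := A / (A + B)).
  assert (Hl : 0 <= l <= 1).
  { unfold l; split; [apply Rdiv_le_0_compat; lra|].
    apply (proj1 (Rdiv_le_1 A (A + B) ltac:(lra))); lra. }
  set (ka := l * (rpow (A + B) p / rpow A p)).
  set (kb := (1 - l) * (rpow (A + B) p / rpow B p)).
  assert (HAp := rpow_gt_0 A p HA). assert (HBp := rpow_gt_0 B p HB).
  assert (HABp := rpow_ge_0 (A + B) p).
  assert (Hka : 0 <= ka) by
    (apply Rmult_le_pos; [lra|apply Rdiv_le_0_compat; lra]).
  assert (Hkb : 0 <= kb) by
    (apply Rmult_le_pos; [lra|apply Rdiv_le_0_compat; lra]).
  assert (ef := ex_RInt_rpow p f 0 (2 * PI) ltac:(lra) cf).
  assert (eg := ex_RInt_rpow p g 0 (2 * PI) ltac:(lra) cg).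
  apply Rle_trans with
    (RInt (fun t => ka * rpow (f t) p + kb * rpow (g t) p) 0 (2 * PI)).
  { apply RInt_le; [lra|apply ex_RInt_rpow; [lra|exact cs]| |].
    - apply (ex_RInt_plus (V := R_NormedModule));
        apply (ex_RInt_scal (V := R_NormedModule)); assumption.
    - intros t _.
      specialize (pf t); specialize (pg t).
      replace (f t + g t) with ((A + B) * (l * (f t / A) + (1 - l) * (g t / B)))
        by (unfold l; field; lra).
      assert (0 <= f t / A) by (apply Rdiv_le_0_compat; lra).
      assert (0 <= g t / B) by (apply Rdiv_le_0_compat; lra).
      assert (0 <= l * (f t / A) + (1 - l) * (g t / B))
        by (apply Rplus_le_le_0_compat; apply Rmult_le_pos; lra).
      rewrite rpow_mult by lra.
      apply Rle_trans with (rpow (A + B) p *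
         (l * rpow (f t / A) p + (1 - l) * rpow (g t / B) p)).
      { apply Rmult_le_compat_l; [lra|]. now apply rpow_convex. }
      replace (rpow (f t) p) with (rpow A p * rpow (f t / A) p)
        by (rewrite <- rpow_mult by lra; f_equal; field; lra).
      replace (rpow (g t) p) with (rpow B p * rpow (g t / B) p)
        by (rewrite <- rpow_mult by lra; f_equal; field; lra).
      apply Req_le. unfold ka, kb. field. lra. }
  rewrite (RInt_plus (V := R_CompleteNormedModule));
    try (apply (ex_RInt_scal (V := R_NormedModule)); assumption).
  rewrite !(RInt_scal (V := R_CompleteNormedModule)) by assumption.
  unfold plus, scal; simpl; unfold mult; simpl.
  assert (H1 := Rmult_le_compat_l ka _ _ Hka If).
  assert (H2 := Rmult_le_compat_l kb _ _ Hkb Ig).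
  replace (2 * PI * rpow (A + B) p)
    with (ka * (2 * PI * rpow A p) + kb * (2 * PI * rpow B p)); [lra|].
  unfold ka, kb. field. lra.
Qed.

Lemma pmean_le_root p h B : 1 <= p -> 0 <= B -> (forall t, continuous h t) ->
  (forall t, 0 <= h t) ->
  pmean_le p h B <->
  rpow (/ (2 * PI) * RInt (fun t => rpow (h t) p) 0 (2 * PI)) (/ p) <= B.
Proof.
  intros Hp HB ch ph. assert (HPI := PI_RGT_0).
  pose (I := RInt (fun t => rpow (h t) p) 0 (2 * PI) : R).
  change (pmean_le p h B <-> rpow (/ (2 * PI) * I) (/ p) <= B).
  assert (HI : 0 <= I).
  { apply RInt_ge_0; [lra|apply ex_RInt_rpow; [lra|exact ch]|].
    intros; apply rpow_ge_0. }
  assert (HX : 0 <= / (2 * PI) * I)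
    by (apply Rmult_le_pos; [apply Rlt_le, Rinv_0_lt_compat; lra|exact HI]).
  assert (EI : I = 2 * PI * (/ (2 * PI) * I)) by (field; lra).
  split.
  - intros (_ & _ & H). change (I <= 2 * PI * rpow B p) in H.
    rewrite <- (rpow_inv_r B p) by lra.
    apply rpow_le; [apply Rlt_le, Rinv_0_lt_compat; lra|].
    apply Rmult_le_reg_l with (2 * PI); lra.
  - intros H. split; [exact ch|split; [exact ph|]].
    change (I <= 2 * PI * rpow B p). rewrite EI.
    apply Rmult_le_compat_l; [lra|].
    rewrite <- (rpow_inv_l (/ (2 * PI) * I) p) by lra.
    apply rpow_le; lra.
Qed.

Lemma pmean_le_limit p f B : 1 <= p -> 0 <= B ->
  (forall e, 0 < e -> pmean_le p f (B + e)) -> pmean_le p f B.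
Proof.
  intros Hp HB H. destruct (H 1 Rlt_0_1) as (cf & pf & _).
  apply pmean_le_root; try assumption.
  apply Rle_plus_epsilon. intros e He.
  apply pmean_le_root; try assumption; [lra|]. now apply H.
Qed.

Lemma pmean_le_scal p f A c : 0 < p -> 0 <= A -> 0 <= c ->
  pmean_le p f A -> pmean_le p (fun t => c * f t) (c * A).
Proof.
  intros Hp HA Hc (cf & pf & If). assert (HPI := PI_RGT_0).
  split; [|split].
  - intros t. apply (continuous_scal_r (V := R_NormedModule) c f), cf.
  - intros t. apply Rmult_le_pos; auto.
  - rewrite (RInt_ext _ (fun t => rpow c p * rpow (f t) p))
      by (intros t _; apply rpow_mult; auto).
    rewrite (RInt_scal (V := R_CompleteNormedModule)) by (apply ex_RInt_rpow; auto).
    rewrite rpow_mult by lra. unfold scal; simpl; unfold mult; simpl.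
    replace (2 * PI * (rpow c p * rpow A p)) with (rpow c p * (2 * PI * rpow A p)) by ring.
    apply Rmult_le_compat_l; [apply rpow_ge_0|exact If].
Qed.

Lemma pmean_le_const p c : 0 <= c -> pmean_le p (fun _ => c) c.
Proof.
  intros Hc. split; [|split].
  - intros t. apply continuous_const.
  - auto.
  - rewrite RInt_const. unfold scal; simpl; unfold mult; simpl. lra.
Qed.

Lemma pmean_le_mono p f g A B : 0 < p -> A <= B -> (forall t, continuous f t) ->
  (forall t, 0 <= f t) -> (forall t, 0 <= t <= 2 * PI -> f t <= g t) ->
  pmean_le p g A -> pmean_le p f B.
Proof.
  intros Hp HAB cf pf Hfg (cg & pg & Ig). assert (HPI := PI_RGT_0).
  split; [exact cf|split; [exact pf|]].
  apply Rle_trans with (RInt (fun t => rpow (g t) p) 0 (2 * PI)).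
  - apply RInt_le; [lra|now apply ex_RInt_rpow|now apply ex_RInt_rpow|].
    intros t Ht. apply rpow_le; [lra|apply Hfg; lra].
  - apply Rle_trans with (1 := Ig).
    apply Rmult_le_compat_l; [lra|]. apply rpow_le; lra.
Qed.

Lemma pmean_le_sum p (h : nat -> R -> R) (B : nat -> R) N : 1 <= p ->
  (forall j, (j <= N)%nat -> 0 < B j /\ pmean_le p (h j) (B j)) ->
  pmean_le p (fun t => sum_f_R0 (fun j => h j t) N) (sum_f_R0 B N).
Proof.
  intros Hp. induction N as [|N IH]; intros H; simpl.
  - apply H; lia.
  - apply pmean_le_plus; [lra| | | |].
    + apply tech1. intros j Hj. apply H; lia.
    + apply H; lia.
    + apply IH. intros j Hj. apply H; lia.
    + apply H; lia.
Qed.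

(** Lower bound for the increment of a power, which telescopes in [sum_pow_le]. *)
Lemma pow_increment_ge a m : 0 <= a -> INR (S m) * a ^ m <= (a + 1) ^ S m - a ^ S m.
Proof.
  intros Ha. induction m as [|m IH].
  - simpl; lra.
  - rewrite S_INR.
    assert (H : a ^ S m <= (a + 1) ^ S m) by (apply pow_incr; lra).
    assert (H2 := Rmult_le_compat_l a _ _ Ha IH).
    change (a ^ S (S m)) with (a * a ^ S m).
    change ((a+1) ^ S (S m)) with ((a + 1) * (a+1) ^ S m).
    change (a ^ S m) with (a * a ^ m) in *. nra.
Qed.

(** The sum is compared with the integral of [x^m] from [1] to [N + 2]. *)
Lemma sum_pow_le m N :
  INR (S m) * sum_f_R0 (fun j => INR (S j) ^ m) N <= INR (S (S N)) ^ S m.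
Proof.
  induction N as [|N IH].
  - unfold sum_f_R0. change (INR 1) with 1.
    assert (H := pow_increment_ge 1 m ltac:(lra)).
    replace (INR 2) with (1 + 1) by (simpl; ring).
    rewrite (pow1 (S m)) in H. lra.
  - rewrite tech5, Rmult_plus_distr_l.
    assert (H := pow_increment_ge (INR (S (S N))) m (pos_INR _)).
    rewrite <- S_INR in H. lra.
Qed.

(** * Continuity of complex valued functions *)

Lemma Cmod_minus_sym (a b : C) : Cmod (a - b) = Cmod (b - a).
Proof. rewrite <- Cmod_opp. f_equal. ring. Qed.

Lemma Cmod_minus_triangle (a b c : C) :
  Cmod (a - c) <= Cmod (a - b) + Cmod (b - c).
Proof.
  replace (a - c)%C with ((a - b) + (b - c))%C by ring. apply Cmod_triangle.
Qed.

Lemma Cmod_norm_R (x : C) : @norm R_AbsRing C_R_NormedModule x = Cmod x.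
Proof.
  change (sqrt (Rabs (fst x) ^ 2 + Rabs (snd x) ^ 2) = Cmod x).
  now rewrite !pow2_abs.
Qed.

Lemma filterlim_C {T : Type} (F : (T -> Prop) -> Prop) {FF : Filter F}
  (f : T -> C) (l : C) :
  filterlim f F (locally l) <-> forall e, 0 < e -> F (fun x => Cmod (f x - l) < e).
Proof.
  split.
  - intros H e He. apply (H (fun y => Cmod (y - l) < e)).
    exact (@locally_ball_norm C_AbsRing C_NormedModule l (mkposreal e He)).
  - intros H. apply (proj2 (@filterlim_locally T C_UniformSpace F FF f l)).
    intros e. generalize (H e (cond_pos e)). apply filter_imp.
    intros x Hx. exact (@norm_compat1 C_AbsRing C_NormedModule l (f x) e Hx).
Qed.

Lemma continuous_C_pair {U : UniformSpace} (f : U -> C) x :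
  continuous (fun t => fst (f t)) x -> continuous (fun t => snd (f t)) x ->
  @continuous U C_UniformSpace f x.
Proof.
  intros H1 H2.
  apply (continuous_ext (fun t => (fst (f t), snd (f t)))).
  { intros t; now destruct (f t). }
  refine (continuous_comp_2 (fun t => fst (f t)) (fun t => snd (f t)) pair x H1 H2 _).
  apply continuous_ext with (fun x => x); [now intros []|apply continuous_id].
Qed.

Lemma continuous_C_fst {U : UniformSpace} (f : U -> C) x :
  @continuous U C_UniformSpace f x -> continuous (fun t => fst (f t)) x.
Proof.
  intros H. apply (continuous_comp f (fst : C -> R)); [exact H|].
  destruct (f x). apply (@continuous_fst R_UniformSpace R_UniformSpace).
Qed.

Lemma continuous_C_snd {U : UniformSpace} (f : U -> C) x :
  @continuous U C_UniformSpace f x -> continuous (fun t => snd (f t)) x.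
Proof.
  intros H. apply (continuous_comp f (snd : C -> R)); [exact H|].
  destruct (f x). apply (@continuous_snd R_UniformSpace R_UniformSpace).
Qed.

Lemma continuous_C_plus {U : UniformSpace} (f g : U -> C) x :
  @continuous U C_UniformSpace f x -> @continuous U C_UniformSpace g x ->
  @continuous U C_UniformSpace (fun t => f t + g t)%C x.
Proof. intros. now apply (@continuous_plus U C_AbsRing C_NormedModule). Qed.

Lemma continuous_C_mult {U : UniformSpace} (f g : U -> C) x :
  @continuous U C_UniformSpace f x -> @continuous U C_UniformSpace g x ->
  @continuous U C_UniformSpace (fun t => f t * g t)%C x.
Proof.
  intros Hf Hg. apply continuous_C_pair; unfold Cmult; simpl.
  - apply (continuous_minus (V := R_NormedModule));
      apply (continuous_mult (K := R_AbsRing));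
      auto using continuous_C_fst, continuous_C_snd.
  - apply (continuous_plus (V := R_NormedModule));
      apply (continuous_mult (K := R_AbsRing));
      auto using continuous_C_fst, continuous_C_snd.
Qed.

Lemma continuous_C_pow {U : UniformSpace} (f : U -> C) n x :
  @continuous U C_UniformSpace f x ->
  @continuous U C_UniformSpace (fun t => f t ^ n)%C x.
Proof.
  intros Hf. induction n as [|n IH].
  - apply continuous_const.
  - now apply (continuous_C_mult f (fun t => f t ^ n)%C).
Qed.

Lemma continuous_RtoC {U : UniformSpace} (f : U -> R) x :
  continuous f x -> @continuous U C_UniformSpace (fun t => RtoC (f t)) x.
Proof. intros H. apply continuous_C_pair; [exact H|apply continuous_const]. Qed.

Lemma continuous_Cmod_comp {U : UniformSpace} (f : U -> C) x :
  @continuous U C_UniformSpace f x -> continuous (fun t => Cmod (f t)) x.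
Proof.
  intros H. apply (continuous_comp f Cmod); [exact H|].
  exact (@filterlim_norm C_AbsRing C_NormedModule (f x)).
Qed.

(** * Complex power series *)

(** Partial sum [a_0 + a_1 w + ... + a_N w^N] of a complex power series; the last
    index [N] is included. *)
Fixpoint psum (a : nat -> C) (N : nat) (w : C) : C :=
  match N with
  | O => a O
  | S N => psum a N w + w ^ S N * a (S N)
  end%C.

Lemma sum_n_psum a w N :
  @sum_n C_NormedModule (fun k => @scal C_AbsRing C_NormedModule (@pow_n C_Ring w k) (a k)) N
  = psum a N w.
Proof.
  assert (Hp : forall k, @pow_n C_Ring w k = (w ^ k)%C).
  { intros k; induction k as [|k IH]; [reflexivity|]. simpl. rewrite IH. reflexivity. }
  induction N as [|N IH].
  - rewrite sum_O. change (1 * a O = a O)%C. ring.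
  - rewrite sum_Sn, IH, Hp. reflexivity.
Qed.

Lemma is_pseries_C_psum a w (l : C) :
  @is_pseries C_AbsRing C_NormedModule a w l <->
  forall e, 0 < e -> eventually (fun N => Cmod (psum a N w - l) < e).
Proof.
  unfold is_pseries, is_series.
  rewrite <- (filterlim_C eventually).
  split; apply filterlim_ext; intros N; [|symmetry]; apply sum_n_psum.
Qed.

Lemma is_pseries_C_bounded a w (l : C) :
  @is_pseries C_AbsRing C_NormedModule a w l ->
  exists M, forall n, Cmod (a n) * Cmod w ^ n <= M.
Proof.
  intros H. assert (H' := proj1 (is_pseries_C_psum a w l) H).
  destruct (H' 1 Rlt_0_1) as [N HN].
  assert (HF : exists M, forall n, (n <= N)%nat -> Cmod (a n) * Cmod w ^ n <= M).
  { clear. induction N as [|N [M IH]].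
    - exists (Cmod (a O) * Cmod w ^ 0). intros n Hn. replace n with O by lia. lra.
    - exists (Rmax M (Cmod (a (S N)) * Cmod w ^ S N)). intros n Hn.
      destruct (Nat.eq_dec n (S N)) as [->|E]; [apply Rmax_r|].
      eapply Rle_trans; [apply IH; lia|apply Rmax_l]. }
  destruct HF as [M HM]. exists (Rmax M 2). intros n.
  destruct (Nat.le_gt_cases n N) as [Hn|Hn].
  - eapply Rle_trans; [now apply HM|apply Rmax_l].
  - eapply Rle_trans; [|apply Rmax_r]. destruct n as [|n]; [lia|].
    rewrite <- Cmod_pow, <- Cmod_mult.
    replace (a (S n) * w ^ S n)%C with ((psum a (S n) w - l) + (l - psum a n w))%C
      by (change (psum a (S n) w) with (psum a n w + w ^ S n * a (S n))%C; ring).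
    eapply Rle_trans; [apply Cmod_triangle|].
    rewrite (Cmod_minus_sym l).
    assert (H1 := HN (S n) ltac:(lia)). assert (H2 := HN n ltac:(lia)). lra.
Qed.

(** Boundedness of the terms at radius [r] makes the tail geometric for
    [|w| <= q r], where the convergence is therefore uniform. *)
Lemma psum_tail a w (l : C) r M q N : 0 <= q < 1 ->
  (forall n, Cmod (a n) * r ^ n <= M) -> Cmod w <= q * r ->
  @is_pseries C_AbsRing C_NormedModule a w l ->
  Cmod (l - psum a N w) <= M / (1 - q) * q ^ N.
Proof.
  intros Hq HM Hw Hl.
  assert (HM0 : 0 <= M).
  { specialize (HM O). simpl in HM. assert (H := Cmod_ge_0 (a O)). lra. }
  assert (Hterm : forall n, Cmod (w ^ n * a n) <= M * q ^ n).
  { intros n. rewrite Cmod_mult, Cmod_pow.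
    apply Rle_trans with ((q * r) ^ n * Cmod (a n)).
    - apply Rmult_le_compat_r; [apply Cmod_ge_0|].
      apply pow_incr; split; [apply Cmod_ge_0|exact Hw].
    - rewrite Rpow_mult_distr.
      replace (q ^ n * r ^ n * Cmod (a n)) with (q ^ n * (Cmod (a n) * r ^ n)) by ring.
      rewrite (Rmult_comm M). apply Rmult_le_compat_l; [now apply pow_le|apply HM]. }
  assert (Hk : forall k, Cmod (psum a (N + k) w - psum a N w)
                <= M / (1 - q) * (q ^ N - q ^ (N + k))).
  { induction k as [|k IH].
    - rewrite Nat.add_0_r. replace (psum a N w - psum a N w)%C with (RtoC 0) by ring.
      rewrite Cmod_0. lra.
    - rewrite Nat.add_succ_r.
      replace (psum a (S (N + k)) w - psum a N w)%C with
        ((psum a (N + k) w - psum a N w) + w ^ S (N + k) * a (S (N + k)))%C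
        by (change (psum a (S (N + k)) w) with
              (psum a (N + k) w + w ^ S (N + k) * a (S (N + k)))%C; ring).
      eapply Rle_trans; [apply Cmod_triangle|].
      specialize (Hterm (S (N + k))).
      assert (E : M / (1 - q) * (q ^ N - q ^ S (N + k)) =
        M / (1 - q) * (q ^ N - q ^ (N + k)) + M * q ^ (N + k))
        by (simpl; field; lra).
      rewrite E. apply Rplus_le_compat; [exact IH|].
      eapply Rle_trans; [exact Hterm|]. simpl.
      apply Rmult_le_compat_l; [exact HM0|].
      rewrite <- (Rmult_1_l (q ^ (N + k))) at 2.
      apply Rmult_le_compat_r; [apply pow_le; lra|lra]. }
  apply Rle_plus_epsilon. intros e He.
  pose proof (proj1 (is_pseries_C_psum a w l) Hl) as Hl'. destruct (Hl' e He) as [N1 HN1].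
  specialize (HN1 (N + N1)%nat ltac:(lia)). specialize (Hk N1).
  eapply Rle_trans; [apply (Cmod_minus_triangle _ (psum a (N + N1) w))|].
  rewrite (Cmod_minus_sym l).
  assert (0 <= M / (1 - q)) by (apply Rdiv_le_0_compat; lra).
  assert (0 <= M / (1 - q) * q ^ (N + N1))
    by (apply Rmult_le_pos; [assumption|apply pow_le; lra]).
  lra.
Qed.

Lemma pow_small K q e : 0 <= q < 1 -> 0 < e -> exists N, K * q ^ N < e.
Proof.
  intros Hq He.
  assert (HK : 0 < Rabs K + 1) by (assert (H := Rabs_pos K); lra).
  destruct (pow_lt_1_zero q ltac:(rewrite Rabs_pos_eq; lra) (e / (Rabs K + 1)))
    as [N HN]; [now apply Rdiv_lt_0_compat|].
  exists N. specialize (HN N (le_n _)). rewrite Rabs_pos_eq in HN by (apply pow_le; lra).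
  assert (Hp : 0 <= q ^ N) by (apply pow_le; lra).
  apply Rle_lt_trans with ((Rabs K + 1) * q ^ N).
  - apply Rmult_le_compat_r; [exact Hp|]. assert (H := Rle_abs K); lra.
  - apply Rmult_lt_compat_l with (r := Rabs K + 1) in HN; [|exact HK].
    replace ((Rabs K + 1) * (e / (Rabs K + 1))) with e in HN by (field; lra). exact HN.
Qed.

(** * Termwise primitives of power series *)

(** [l] is the derivative at [s] of the complex valued function [f] of a real
    variable.  The definition is componentwise, so that the rules for real valued
    functions apply. *)
Definition cder (f : R -> C) (s : R) (l : C) : Prop :=
  is_derive (fun t => fst (f t)) s (fst l) /\ is_derive (fun t => snd (f t)) s (snd l).

Lemma cder_const c s : cder (fun _ => c) s 0.
Proof. split; apply (is_derive_const (V := R_NormedModule)). Qed.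

Lemma cder_plus f g s l m :
  cder f s l -> cder g s m -> cder (fun t => f t + g t)%C s (l + m)%C.
Proof.
  intros [H1 H2] [H3 H4]; split; apply (is_derive_plus (V := R_NormedModule)); assumption.
Qed.

Lemma cder_mult f g s l m :
  cder f s l -> cder g s m -> cder (fun t => f t * g t)%C s (l * g s + f s * m)%C.
Proof.
  intros [H1 H2] [H3 H4]; split; unfold Cmult, Cplus; simpl.
  - replace (fst l * fst (g s) - snd l * snd (g s) + (fst (f s) * fst m - snd (f s) * snd m))
      with (minus (plus (mult (fst l) (fst (g s))) (mult (fst (f s)) (fst m)))
                  (plus (mult (snd l) (snd (g s))) (mult (snd (f s)) (snd m))))
      by (unfold minus, plus, mult, opp; simpl; ring).
    apply (is_derive_minus (V := R_NormedModule));
      apply (is_derive_mult (K := R_AbsRing)); auto using Rmult_comm.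
  - replace (fst l * snd (g s) + snd l * fst (g s) + (fst (f s) * snd m + snd (f s) * fst m))
      with (plus (plus (mult (fst l) (snd (g s))) (mult (fst (f s)) (snd m)))
                 (plus (mult (snd l) (fst (g s))) (mult (snd (f s)) (fst m))))
      by (unfold minus, plus, mult, opp; simpl; ring).
    apply (is_derive_plus (V := R_NormedModule));
      apply (is_derive_mult (K := R_AbsRing)); auto using Rmult_comm.
Qed.

Lemma cder_line (a u : C) s : cder (fun t => a + t * u)%C s u.
Proof.
  split; simpl; auto_derive; auto; ring.
Qed.

Lemma cder_pow f s l n :
  cder f s l -> cder (fun t => f t ^ S n)%C s (INR (S n) * f s ^ n * l)%C.
Proof.
  intros H. induction n as [|n IH].
  - replace (INR 1 * f s ^ 0 * l)%C with (l * 1 + f s * 0)%C by (simpl; ring).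
    apply (cder_mult f (fun _ => RtoC 1)); [exact H|apply cder_const].
  - replace (INR (S (S n)) * f s ^ S n * l)%C with
      (l * f s ^ S n + f s * (INR (S n) * f s ^ n * l))%C.
    + now apply (cder_mult f (fun t => f t ^ S n)%C).
    + rewrite (S_INR (S n)), RtoC_plus. rewrite (Cpow_S (f s) n). ring.
Qed.

(** Fundamental theorem of calculus along a real parameter. *)
Lemma is_RInt_cder f df a b : (forall s, cder f s (df s)) ->
  (forall s, @continuous R_UniformSpace C_UniformSpace df s) ->
  @is_RInt C_R_NormedModule df a b (f b - f a)%C.
Proof.
  intros H Hc.
  apply (@is_RInt_fct_extend_pair R_NormedModule R_NormedModule df a b
    (fst (f b) - fst (f a)) (snd (f b) - snd (f a))).
  - apply (@is_RInt_derive R_CompleteNormedModule (fun t => fst (f t))).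
    + intros; apply H.
    + intros; now apply continuous_C_fst.
  - apply (@is_RInt_derive R_CompleteNormedModule (fun t => snd (f t))).
    + intros; apply H.
    + intros; now apply continuous_C_snd.
Qed.

(** Coefficients of the primitive, with constant term [c], of the power series with
    coefficients [a]. *)
Definition prim_coef (c : C) (a : nat -> C) (n : nat) : C :=
  match n with O => c | S n => (a n / INR (S n))%C end.

Lemma INR_S_neq_0 n : RtoC (INR (S n)) <> 0.
Proof. intros H. apply RtoC_inj in H. revert H. apply not_0_INR; lia. Qed.

Lemma continuous_psum {U : UniformSpace} a N (f : U -> C) x :
  @continuous U C_UniformSpace f x ->
  @continuous U C_UniformSpace (fun t => psum a N (f t)) x.
Proof.
  intros Hf. induction N as [|N IH].
  - apply continuous_const.
  - apply (continuous_C_plus (fun t => psum a N (f t))); [exact IH|].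
    apply (continuous_C_mult (fun t => f t ^ S N)%C).
    + now apply continuous_C_pow.
    + apply continuous_const.
Qed.

Lemma cder_psum_prim c a f s l N : cder f s l ->
  cder (fun t => psum (prim_coef c a) (S N) (f t)) s (l * psum a N (f s))%C.
Proof.
  intros H. induction N as [|N IH].
  - change (cder (fun t => c + f t ^ 1 * (a O / INR 1))%C s (l * a O)%C).
    replace (l * a O)%C with (0 + (INR 1 * f s ^ 0 * l * (a O / INR 1) + f s ^ 1 * 0))%C
      by (simpl; field).
    apply (cder_plus (fun _ => c)); [apply cder_const|].
    apply (cder_mult (fun t => f t ^ 1)%C); [now apply cder_pow|apply cder_const].
  - change (cder (fun t => psum (prim_coef c a) (S N) (f t) +
               f t ^ S (S N) * (a (S N) / INR (S (S N))))%C s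
             (l * (psum a N (f s) + f s ^ S N * a (S N)))%C).
    replace (l * (psum a N (f s) + f s ^ S N * a (S N)))%C with
      (l * psum a N (f s) + (INR (S (S N)) * f s ^ S N * l * (a (S N) / INR (S (S N)))
         + f s ^ S (S N) * 0))%C
      by (field; apply INR_S_neq_0).
    apply cder_plus; [exact IH|].
    apply (cder_mult (fun t => f t ^ S (S N))%C); [now apply cder_pow|apply cder_const].
Qed.

Lemma continuous_line (a u : C) s :
  @continuous R_UniformSpace C_UniformSpace (fun t => a + t * u)%C s.
Proof.
  apply (continuous_C_plus (fun _ => a)); [apply continuous_const|].
  apply (continuous_C_mult (fun t : R => RtoC t)); [|apply continuous_const].
  apply (continuous_RtoC (fun t => t)), continuous_id.
Qed.

Lemma psum_0 a N : psum a N 0 = a O.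
Proof.
  induction N as [|N IH]; [reflexivity|].
  change (psum a N 0 + 0 ^ S N * a (S N) = a O)%C. rewrite IH, Cpow_S. ring.
Qed.

(** * Local primitives and analyticity of V *)

(** Discs are convex. *)
Lemma Cmod_line_between (a u c : C) (r t1 t2 s : R) : t1 <= s <= t2 ->
  Cmod (a + t1 * u - c) < r -> Cmod (a + t2 * u - c) < r ->
  Cmod (a + s * u - c) < r.
Proof.
  intros Hs H1 H2.
  destruct (Req_dec t1 t2) as [E|E].
  { replace s with t1 by lra. exact H1. }
  set (l := (t2 - s) / (t2 - t1)).
  assert (Hl : 0 <= l) by (apply Rdiv_le_0_compat; lra).
  assert (Hl' : 0 <= 1 - l).
  { replace (1 - l) with ((s - t1) / (t2 - t1)) by (unfold l; field; lra).
    apply Rdiv_le_0_compat; lra. }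
  assert (Es : s = l * t1 + (1 - l) * t2) by (unfold l; field; lra).
  replace (a + s * u - c)%C with
    (RtoC l * (a + t1 * u - c) + RtoC (1 - l) * (a + t2 * u - c))%C
    by (rewrite Es, RtoC_plus, !RtoC_mult, RtoC_minus; ring).
  eapply Rle_lt_trans; [apply Cmod_triangle|].
  rewrite !Cmod_mult, !Cmod_R, !Rabs_pos_eq by assumption.
  destruct (Req_dec l 0) as [->|Hl0]; [lra|].
  assert (l * Cmod (a + t1 * u - c) < l * r) by (apply Rmult_lt_compat_l; lra).
  assert ((1 - l) * Cmod (a + t2 * u - c) <= (1 - l) * r)
    by (apply Rmult_le_compat_l; lra).
  lra.
Qed.

Lemma unit_disc_ray (s : R) (z : C) : 0 <= s <= 1 -> unit_disc z ->
  unit_disc (s * z)%C.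
Proof.
  unfold unit_disc. intros Hs Hz.
  rewrite Cmod_mult, Cmod_R, Rabs_pos_eq by lra.
  assert (H := Cmod_ge_0 z). nra.
Qed.

(** The terms of the series are bounded at radius [rho / 2], which gives uniform
    geometric convergence, of ratio [1 / 2], up to radius [rho / 4]. *)
Lemma pseries_uniform (phi : C -> C) (c : C) a rho : 0 < rho ->
  (forall z : C, Cmod (z - c)%C < rho ->
        @is_pseries C_AbsRing C_NormedModule a (z - c)%C (phi z)) ->
  exists K, forall N z, Cmod (z - c) <= rho / 4 ->
    Cmod (phi z - psum a N (z - c)) <= K * (1 / 2) ^ N.
Proof.
  intros Hr Ha.
  assert (E : (c + RtoC (rho / 2) - c = RtoC (rho / 2))%C) by ring.
  assert (Hm : Cmod (RtoC (rho / 2)) = rho / 2) by (rewrite Cmod_R, Rabs_pos_eq; lra).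
  assert (H0 := Ha (c + RtoC (rho / 2))%C). rewrite E, Hm in H0.
  destruct (is_pseries_C_bounded _ _ _ (H0 ltac:(lra))) as [M HM]. rewrite Hm in HM.
  exists (M / (1 - 1 / 2)). intros N z Hz.
  apply psum_tail with (r := rho / 2); [lra|exact HM|lra|apply Ha; lra].
Qed.

Lemma analytic_continuous phi z : analytic_disc phi -> unit_disc z ->
  @continuous C_UniformSpace C_UniformSpace phi z.
Proof.
  intros Hphi Hz. destruct (Hphi z Hz) as (a & rho & Hr & Ha).
  destruct (pseries_uniform phi z a rho Hr Ha) as [K HK].
  apply filterlim_C; [apply locally_filter|]. intros e He.
  destruct (pow_small K (1 / 2) (e / 3)) as [N HN]; [lra|lra|].
  assert (Hc : @continuous C_UniformSpace C_UniformSpace (fun w => psum a N (w - z))%C z).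
  { apply continuous_psum. apply (continuous_C_plus (fun w => w)).
    - apply continuous_id.
    - apply continuous_const. }
  assert (H1 := proj1 (filterlim_C (locally z) (fun w => psum a N (w - z))%C _) Hc
                 (e / 3) ltac:(lra)).
  assert (H2 := @locally_ball_norm C_AbsRing C_NormedModule z
                  (mkposreal (rho / 4) ltac:(lra))).
  generalize (filter_and _ _ H1 H2). apply filter_imp. intros w [Hw1 Hw2].
  change (Cmod (w - z) < rho / 4) in Hw2.
  assert (H3 := HK N w ltac:(lra)).
  assert (H4 := HK N z). replace (z - z)%C with (RtoC 0) in * by ring.
  rewrite Cmod_0 in H4. specialize (H4 ltac:(lra)).
  rewrite Cmod_minus_sym in H4.
  replace (phi w - phi z)%C with ((phi w - psum a N (w - z)) +
    ((psum a N (w - z) - psum a N 0) + (psum a N 0 - phi z)))%C by ring.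
  eapply Rle_lt_trans; [apply Cmod_triangle|].
  assert (H5 := Cmod_triangle (psum a N (w - z) - psum a N 0) (psum a N 0 - phi z)).
  lra.
Qed.

Lemma continuous_path phi (a u : C) (s : R) : analytic_disc phi -> unit_disc (a + s * u)%C ->
  @continuous R_UniformSpace C_UniformSpace (fun t => phi (a + t * u)%C) s.
Proof.
  intros Hphi Hs.
  apply (continuous_comp (fun t : R => a + t * u)%C phi); [apply continuous_line|].
  now apply analytic_continuous.
Qed.

Lemma continuous_path_mult phi (a u : C) (s : R) : analytic_disc phi -> unit_disc (a + s * u)%C ->
  @continuous R_UniformSpace C_UniformSpace (fun t => u * phi (a + t * u))%C s.
Proof.
  intros Hphi Hs. apply (continuous_C_mult (fun _ => u)).
  - apply continuous_const.
  - now apply continuous_path.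
Qed.

(** Integral of [phi] along the segment of the points [a + s u], [t1 <= s <= t2]. *)
Definition path_int (phi : C -> C) (a u : C) (t1 t2 : R) : C :=
  @RInt C_R_CompleteNormedModule (fun s : R => u * phi (a + s * u))%C t1 t2.

Lemma path_int_correct phi (a u : C) (t1 t2 : R) : analytic_disc phi -> t1 <= t2 ->
  (forall s : R, t1 <= s <= t2 -> unit_disc (a + s * u)%C) ->
  @is_RInt C_R_NormedModule (fun s : R => u * phi (a + s * u))%C t1 t2
    (path_int phi a u t1 t2).
Proof.
  intros Hphi Ht Hs. apply (@RInt_correct C_R_CompleteNormedModule).
  apply (@ex_RInt_continuous C_R_CompleteNormedModule). intros s Hs'.
  rewrite Rmin_left, Rmax_right in Hs' by lra.
  apply continuous_path_mult; auto.
Qed.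

Lemma path_int_Chasles phi (a u : C) (t1 t2 t3 : R) : analytic_disc phi -> t1 <= t2 <= t3 ->
  (forall s : R, t1 <= s <= t3 -> unit_disc (a + s * u)%C) ->
  path_int phi a u t1 t3 = (path_int phi a u t1 t2 + path_int phi a u t2 t3)%C.
Proof.
  intros Hphi Ht Hs.
  apply (@is_RInt_unique C_R_CompleteNormedModule).
  apply (@is_RInt_Chasles C_R_NormedModule _ t1 t2 t3 _ _);
    apply path_int_correct; try lra; auto; intros; apply Hs; lra.
Qed.

(** [G] is a primitive of [phi] on the disc of centre [c] and radius [r]:
    integrals of [phi] along segments of that disc are differences of [G].  The
    disc is required to lie in the unit disc. *)
Definition primitive_on (phi G : C -> C) (c : C) (r : R) : Prop :=
  (forall z, Cmod (z - c) < r -> unit_disc z) /\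
  forall (a u : C) (t1 t2 : R), t1 <= t2 ->
    Cmod (a + t1 * u - c) < r -> Cmod (a + t2 * u - c) < r ->
    path_int phi a u t1 t2 = (G (a + t2 * u) - G (a + t1 * u))%C.

Lemma primitive_on_sub phi G c r c' r' : Cmod (c' - c) + r' <= r ->
  primitive_on phi G c r -> primitive_on phi G c' r'.
Proof.
  intros Hr [H1 H2].
  assert (H : forall z, Cmod (z - c') < r' -> Cmod (z - c) < r).
  { intros z Hz. eapply Rle_lt_trans; [apply (Cmod_minus_triangle _ c')|]. lra. }
  split; [intros z Hz; auto|].
  intros a u t1 t2 Ht Ha Hb. auto.
Qed.

(** If a partial sum of the series at [c] approximates [phi] within [K], then its
    formal primitive, with any constant term [b0], computes the integrals of [phi]
    along segments with an error proportional to [K]. *)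
Lemma path_int_psum phi c a rho K N b0 (x u : C) (t1 t2 : R) :
  analytic_disc phi -> t1 <= t2 ->
  (forall z, Cmod (z - c) < rho -> unit_disc z /\
     Cmod (phi z - psum a N (z - c)) <= K) ->
  Cmod (x + t1 * u - c) < rho -> Cmod (x + t2 * u - c) < rho ->
  Cmod (path_int phi x u t1 t2 -
        (psum (prim_coef b0 a) (S N) (x + t2 * u - c) -
         psum (prim_coef b0 a) (S N) (x + t1 * u - c))) <= (t2 - t1) * (Cmod u * K).
Proof.
  intros Hphi Ht HK H1 H2.
  assert (Hin : forall s : R, t1 <= s <= t2 -> Cmod (x + s * u - c) < rho)
    by (intros s Hs; now apply Cmod_line_between with t1 t2).
  assert (Hline : forall s, cder (fun s : R => (x - c) + s * u)%C s u)
    by (intros s; apply cder_line).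
  assert (HP := is_RInt_cder (fun s => psum (prim_coef b0 a) (S N) ((x - c) + s * u)%C)
     (fun s => u * psum a N ((x - c) + s * u))%C t1 t2
     (fun s => cder_psum_prim b0 a _ s u N (Hline s))).
  cbv beta in HP.
  assert (Hc : forall s, @continuous R_UniformSpace C_UniformSpace
     (fun s : R => u * psum a N ((x - c) + s * u))%C s).
  { intros s. apply (continuous_C_mult (fun _ => u)); [apply continuous_const|].
    apply continuous_psum, continuous_line. }
  specialize (HP Hc).
  assert (Hphi' := path_int_correct phi x u t1 t2 Hphi Ht
            (fun s Hs => proj1 (HK _ (Hin s Hs)))).
  assert (HD := @is_RInt_minus C_R_NormedModule _ _ _ _ _ _ Hphi' HP).
  rewrite <- Cmod_norm_R.
  replace (x + t2 * u - c)%C with (x - c + t2 * u)%C by ring.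
  replace (x + t1 * u - c)%C with (x - c + t1 * u)%C by ring.
  refine (@norm_RInt_le_const C_R_NormedModule _ t1 t2 _ _ Ht _ HD).
  intros s Hs. rewrite Cmod_norm_R.
  change (Cmod (u * phi (x + s * u) - u * psum a N (x - c + s * u))%C <= Cmod u * K).
  replace (u * phi (x + s * u) - u * psum a N (x - c + s * u))%C with
    (u * (phi (x + s * u) - psum a N (x + s * u - c)))%C.
  - rewrite Cmod_mult. apply Rmult_le_compat_l; [apply Cmod_ge_0|].
    apply HK, Hin, Hs.
  - replace (x + s * u - c)%C with (x - c + s * u)%C by ring. ring.
Qed.

Lemma Cmod_eq_0_eps (z : C) : (forall e, 0 < e -> Cmod z < e) -> z = 0.
Proof.
  intros H. apply Cmod_eq_0. destruct (Cmod_ge_0 z) as [Hz|Hz]; [|lra].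
  specialize (H _ Hz). lra.
Qed.

(** On a small disc the primitive [G] is the integral of [phi] from the centre;
    up to any additive constant it is the sum of the termwise primitive of the
    series. *)
Lemma local_primitive phi c : analytic_disc phi -> unit_disc c ->
  exists r G, 0 < r /\ primitive_on phi G c r /\
    forall k : C, exists b, forall z, Cmod (z - c) < r ->
      @is_pseries C_AbsRing C_NormedModule b (z - c)%C (G z + k)%C.
Proof.
  intros Hphi Hc. destruct (Hphi c Hc) as (a & rho & Hr & Ha).
  destruct (pseries_uniform phi c a rho Hr Ha) as [K HK].
  unfold unit_disc in Hc.
  set (r := Rmin (rho / 4) (1 - Cmod c)).
  assert (Hrpos : 0 < r) by (apply Rmin_glb_lt; lra).
  assert (Hr1 : r <= rho / 4) by apply Rmin_l.
  assert (Hr2 : r <= 1 - Cmod c) by apply Rmin_r.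
  assert (HN : forall N z, Cmod (z - c) < r -> unit_disc z /\
     Cmod (phi z - psum a N (z - c)) <= K * (1 / 2) ^ N).
  { intros N z Hz. split.
    - unfold unit_disc. replace z with ((z - c) + c)%C by ring.
      eapply Rle_lt_trans; [apply Cmod_triangle|]. lra.
    - apply HK. lra. }
  set (G := fun z => path_int phi c (z - c)%C 0 1).
  assert (HG : forall k N z, Cmod (z - c) < r ->
    Cmod (G z + k - psum (prim_coef k a) (S N) (z - c)) <= r * K * (1 / 2) ^ N).
  { intros k N z Hz.
    assert (H := path_int_psum phi c a r _ N k c (z - c)%C 0 1 Hphi Rle_0_1 (HN N)).
    replace (c + 0 * (z - c) - c)%C with (RtoC 0) in H by ring.
    replace (c + 1 * (z - c) - c)%C with (z - c)%C in H by ring.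
    rewrite Cmod_0, psum_0 in H. specialize (H Hrpos Hz).
    replace (G z + k - psum (prim_coef k a) (S N) (z - c))%C with
      (path_int phi c (z - c) 0 1 - (psum (prim_coef k a) (S N) (z - c) - prim_coef k a O))%C
      by (unfold G; simpl prim_coef; ring).
    eapply Rle_trans; [exact H|].
    assert (0 <= K * (1 / 2) ^ N).
    { eapply Rle_trans; [apply Cmod_ge_0|apply (proj2 (HN N z Hz))]. }
    rewrite Rmult_assoc.
    replace ((1 - 0) * (Cmod (z - c) * (K * (1 / 2) ^ N))) with
       (Cmod (z - c) * (K * (1 / 2) ^ N)) by ring.
    apply Rmult_le_compat_r; lra. }
  exists r, G. split; [exact Hrpos|split; [split|]].
  - intros z Hz. apply (HN O z Hz).
  - intros x u t1 t2 Ht H1 H2.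
    apply Ceq_minus. apply Cmod_eq_0_eps. intros e He.
    set (L := (t2 - t1) * (Cmod u * K) + 2 * (r * K)).
    destruct (pow_small L (1 / 2) e) as [N HNN]; [lra|lra|].
    eapply Rle_lt_trans; [|exact HNN].
    assert (E1 := path_int_psum phi c a r _ N 0 x u t1 t2 Hphi Ht (HN N) H1 H2).
    assert (E2 := HG 0 N _ H1). assert (E3 := HG 0 N _ H2).
    rewrite Cmod_minus_sym in E3.
    set (q1 := psum _ _ (x + t1 * u - c)%C) in *.
    set (q2 := psum _ _ (x + t2 * u - c)%C) in *.
    replace (path_int phi x u t1 t2 - (G (x + t2 * u)%C - G (x + t1 * u)%C))%C with
      ((path_int phi x u t1 t2 - (q2 - q1)) +
       ((G (x + t1 * u)%C + 0 - q1) + (q2 - (G (x + t2 * u)%C + 0))))%C by ring.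
    eapply Rle_trans; [apply Cmod_triangle|].
    assert (E4 := Cmod_triangle (G (x + t1 * u)%C + 0 - q1) (q2 - (G (x + t2 * u)%C + 0))).
    replace (L * (1 / 2) ^ N) with ((t2 - t1) * (Cmod u * (K * (1 / 2) ^ N)) +
      (r * K * (1 / 2) ^ N + r * K * (1 / 2) ^ N)) by (unfold L; ring).
    lra.
  - intros k. exists (prim_coef k a). intros z Hz.
    apply is_pseries_C_psum. intros e He.
    destruct (pow_small (r * K) (1 / 2) e) as [N0 HN0]; [lra|lra|].
    exists (S N0). intros [|N] HNN; [lia|].
    rewrite Cmod_minus_sym. eapply Rle_lt_trans; [apply HG, Hz|].
    eapply Rle_lt_trans; [|exact HN0].
    assert (HK0 : 0 <= K).
    { assert (H := proj2 (HN O z Hz)). simpl in H.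
      assert (H' := Cmod_ge_0 (phi z - psum a 0 (z - c))). simpl in H'. lra. }
    apply Rmult_le_compat_l; [apply Rmult_le_pos; lra|].
    replace ((1 / 2) ^ N) with ((1/2) ^ N0 * (1 / 2) ^ (N - N0))
      by (rewrite <- pow_add; f_equal; lia).
    rewrite <- (Rmult_1_r ((1 / 2) ^ N0)) at 2.
    apply Rmult_le_compat_l; [apply pow_le; lra|].
    apply Rle_trans with (1 ^ (N - N0)); [apply pow_incr; lra|rewrite pow1; lra].
Qed.

(** Lebesgue number argument: along the segment from [0] to [z0] the local
    primitives live on discs of a common radius.  The radius [3 * d] leaves room for
    a step of length [d] along the segment and a shift of size [d] away from it. *)
Lemma uniform_primitive phi z0 : analytic_disc phi -> unit_disc z0 ->
  exists d, 0 < d /\ forall x : R, 0 <= x <= 1 ->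
    exists G, primitive_on phi G (x * z0)%C (3 * d).
Proof.
  intros Hphi Hz0.
  assert (Hd : forall t : R, exists d : posreal, 0 <= t <= 1 ->
     exists G, primitive_on phi G (t * z0)%C (4 * d)).
  { intros t. destruct (classic (0 <= t <= 1)) as [Ht|Ht].
    - assert (Hu : unit_disc (t * z0)%C) by now apply unit_disc_ray.
      destruct (local_primitive phi (t * z0)%C Hphi Hu) as (r & G & Hr & HG & _).
      exists (mkposreal (r / 4) ltac:(lra)). intros _. exists G. simpl.
      replace (4 * (r / 4)) with r by field. exact HG.
    - exists (mkposreal 1 Rlt_0_1). tauto. }
  set (delta := fun t => proj1_sig (constructive_indefinite_description _ (Hd t))).
  assert (Hdelta : forall t : R, 0 <= t <= 1 ->
     exists G, primitive_on phi G (t * z0)%C (4 * delta t))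
    by (intros t; apply (proj2_sig (constructive_indefinite_description _ (Hd t)))).
  destruct (compactness_value_1d 0 1 delta) as [d Hcomp].
  exists d. split; [apply cond_pos|]. intros x Hx.
  destruct (NNPP _ (Hcomp x Hx)) as (t & Ht & Hxt & Hdt).
  destruct (Hdelta t Ht) as [G HG]. exists G.
  eapply primitive_on_sub; [|exact HG].
  replace (x * z0 - t * z0)%C with (RtoC (x - t) * z0)%C by (rewrite RtoC_minus; ring).
  rewrite Cmod_mult, Cmod_R. unfold unit_disc in Hz0.
  assert (Rabs (x - t) * Cmod z0 <= delta t * 1)
    by (apply Rmult_le_compat; [apply Rabs_pos|apply Cmod_ge_0|lra|lra]).
  lra.
Qed.

(** The integral around the triangle with vertices [0], [z0], [w] vanishes when [w]
    is close to [z0]. *)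
Lemma path_int_triangle phi z0 : analytic_disc phi -> unit_disc z0 ->
  exists d, 0 < d /\ forall w, Cmod (w - z0) < d ->
    path_int phi 0 w 0 1 = (path_int phi 0 z0 0 1 + path_int phi z0 (w - z0) 0 1)%C.
Proof.
  intros Hphi Hz0.
  destruct (uniform_primitive phi z0 Hphi Hz0) as (d & Hd & HG).
  assert (Hz1 := Hz0). unfold unit_disc in Hz1.
  exists d. split; [exact Hd|]. intros w Hw.
  assert (Hwd : unit_disc w).
  { destruct (HG 1 ltac:(lra)) as (G & HG1 & _). apply HG1.
    replace (w - 1 * z0)%C with (w - z0)%C by ring. lra. }
  assert (Hray : forall v : C, unit_disc v -> forall s, 0 <= s <= 1 -> unit_disc (0 + s * v)%C).
  { intros v Hv s Hs. rewrite Cplus_0_l. now apply unit_disc_ray. }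
  (* Up to orientation, [J t] is the integral around the triangle with vertices [0],
     [t z0], [t w]. *)
  set (J := fun t : R => (path_int phi 0 w 0 t - path_int phi 0 z0 0 t
               - path_int phi (t * z0) (t * (w - z0)) 0 1)%C).
  (* The quadrilateral between two close values of [t] lies in one disc on which
     [phi] has a primitive, so that its boundary contributes nothing. *)
  assert (Hstep : forall t1 t2, 0 <= t1 <= t2 -> t2 <= 1 -> t2 - t1 < d -> J t2 = J t1).
  { intros t1 t2 H1 H2 H3. destruct (HG t1 ltac:(lra)) as (G & _ & HGp).
    assert (Hz : forall t, t1 <= t <= t2 -> Cmod (t * z0 - t1 * z0) < d).
    { intros t Ht. replace (t * z0 - t1 * z0)%C with (RtoC (t - t1) * z0)%C
        by (rewrite RtoC_minus; ring).
      rewrite Cmod_mult, Cmod_R, Rabs_pos_eq by lra.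
      assert (H := Cmod_ge_0 z0). nra. }
    assert (Hwz : forall t, t1 <= t <= t2 -> Cmod (t * w - t1 * z0) < 3 * d).
    { intros t Ht. specialize (Hz t Ht).
      replace (t * w - t1 * z0)%C with (t * (w - z0) + (t * z0 - t1 * z0))%C by ring.
      eapply Rle_lt_trans; [apply Cmod_triangle|].
      rewrite Cmod_mult, Cmod_R, Rabs_pos_eq by lra.
      assert (t * Cmod (w - z0) <= 1 * Cmod (w - z0))
        by (apply Rmult_le_compat_r; [apply Cmod_ge_0|lra]). lra. }
    assert (HI : forall t, t1 <= t <= t2 ->
      path_int phi (t * z0) (t * (w - z0)) 0 1 = (G (t * w) - G (t * z0))%C).
    { intros t Ht. rewrite HGp; [|lra| |].
      - f_equal; f_equal; ring.
      - replace (t * z0 + 0 * (t * (w - z0)) - t1 * z0)%C with (t * z0 - t1 * z0)%C by ring.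
        specialize (Hz t Ht). lra.
      - replace (t * z0 + 1 * (t * (w - z0)) - t1 * z0)%C with (t * w - t1 * z0)%C by ring.
        auto. }
    unfold J. rewrite (HI t1), (HI t2) by lra.
    rewrite (path_int_Chasles phi 0 w 0 t1 t2), (path_int_Chasles phi 0 z0 0 t1 t2);
      try assumption; try lra; try (intros s Hs; apply Hray; [assumption|lra]).
    rewrite (HGp 0 w t1 t2), (HGp 0 z0 t1 t2); try lra;
      try rewrite !Cplus_0_l;
      try (assert (H := Hz t1); assert (H' := Hz t2); lra);
      try (apply Hwz; lra).
    ring. }
  assert (HJ0 : J 0 = 0).
  { unfold J. unfold path_int at 1 2. rewrite !RInt_point.
    destruct (HG 0 ltac:(lra)) as (G & _ & HGp).
    assert (E : forall s : R, (0 * z0 + s * (0 * (w - z0)))%C = 0) by (intros; ring).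
    rewrite HGp; [|lra| |].
    - rewrite !E. change (@zero C_R_CompleteNormedModule) with (RtoC 0). ring.
    - rewrite E. replace (0 - 0 * z0)%C with (RtoC 0) by ring. rewrite Cmod_0. lra.
    - rewrite E. replace (0 - 0 * z0)%C with (RtoC 0) by ring. rewrite Cmod_0. lra. }
  assert (HJ1 : J 1 = 0).
  { destruct (archimed_cor1 d Hd) as (N & HN & HN0).
    assert (HNp : 0 < INR N) by (now apply lt_0_INR).
    assert (Hj : forall j, (j <= N)%nat -> J (INR j / INR N) = 0).
    { induction j as [|j IH]; intros Hj.
      - simpl INR. replace (0 / INR N) with 0 by (field; lra). exact HJ0.
      - rewrite <- IH by lia.
        assert (Hjn : INR (S j) <= INR N) by (now apply le_INR).
        assert (0 <= INR j) by apply pos_INR.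
        assert (0 < / INR N) by now apply Rinv_0_lt_compat.
        rewrite S_INR in *.
        apply Hstep.
        + split; [apply Rdiv_le_0_compat; lra|]. unfold Rdiv.
          apply Rmult_le_compat_r; lra.
        + apply Rmult_le_reg_r with (INR N); [lra|].
          replace ((INR j + 1) / INR N * INR N) with (INR j + 1) by (field; lra). lra.
        + replace ((INR j + 1) / INR N - INR j / INR N) with (/ INR N) by (field; lra).
          exact HN. }
    rewrite <- (Hj N) by lia. f_equal. field. lra. }
  unfold J in HJ1.
  replace (1 * z0)%C with z0 in HJ1 by ring.
  replace (1 * (w - z0))%C with (w - z0)%C in HJ1 by ring.
  apply Ceq_minus. etransitivity; [|exact HJ1]. ring.
Qed.

Lemma is_RInt_C_mult (u : C) (f : R -> C) a b l :
  @is_RInt C_R_NormedModule f a b l ->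
  @is_RInt C_R_NormedModule (fun s => u * f s)%C a b (u * l)%C.
Proof.
  intros H.
  assert (H1 := @is_RInt_fct_extend_fst R_NormedModule R_NormedModule f a b l H).
  assert (H2 := @is_RInt_fct_extend_snd R_NormedModule R_NormedModule f a b l H).
  apply (@is_RInt_fct_extend_pair R_NormedModule R_NormedModule _ a b
    (fst u * fst l - snd u * snd l) (fst u * snd l + snd u * fst l)).
  - apply (@is_RInt_minus R_NormedModule);
      apply (@is_RInt_scal R_NormedModule); assumption.
  - apply (@is_RInt_plus R_NormedModule);
      apply (@is_RInt_scal R_NormedModule); assumption.
Qed.

Lemma is_RInt_V phi z : analytic_disc phi -> unit_disc z ->
  @is_RInt C_R_NormedModule (fun s : R => z * phi (RtoC s * z))%C 0 1 (V phi z).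
Proof.
  intros Hphi Hz. unfold V. apply is_RInt_C_mult.
  apply (@RInt_correct C_R_CompleteNormedModule).
  apply (@ex_RInt_continuous C_R_CompleteNormedModule). intros s Hs.
  rewrite Rmin_left, Rmax_right in Hs by lra.
  apply continuous_ext with (fun t : R => phi (0 + t * z)%C).
  - intros t. now rewrite Cplus_0_l.
  - apply continuous_path; [assumption|].
    rewrite Cplus_0_l. now apply unit_disc_ray.
Qed.

Lemma V_path_int phi z : analytic_disc phi -> unit_disc z ->
  V phi z = path_int phi 0 z 0 1.
Proof.
  intros Hphi Hz. symmetry. apply (@is_RInt_unique C_R_CompleteNormedModule).
  refine (@is_RInt_ext C_R_NormedModule _ _ _ _ _ _ (is_RInt_V phi z Hphi Hz)).
  intros s _. now rewrite Cplus_0_l.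
Qed.

Lemma analytic_V phi : analytic_disc phi -> analytic_disc (V phi).
Proof.
  intros Hphi z0 Hz0.
  destruct (path_int_triangle phi z0 Hphi Hz0) as (d & Hd & Htri).
  destruct (local_primitive phi z0 Hphi Hz0) as (r & G & Hr & [HG1 HG2] & Hb).
  destruct (Hb (V phi z0 - G z0)%C) as [b Hser].
  exists b, (Rmin d r). split; [now apply Rmin_glb_lt|].
  intros z Hz.
  assert (Hzd : Cmod (z - z0) < d) by (eapply Rlt_le_trans; [exact Hz|apply Rmin_l]).
  assert (Hzr : Cmod (z - z0) < r) by (eapply Rlt_le_trans; [exact Hz|apply Rmin_r]).
  replace (V phi z) with (G z + (V phi z0 - G z0))%C; [now apply Hser|].
  rewrite !V_path_int by auto. rewrite (Htri z Hzd).
  rewrite (HG2 z0 (z - z0)%C 0 1).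
  - replace (z0 + 1 * (z - z0))%C with z by ring.
    replace (z0 + 0 * (z - z0))%C with z0 by ring. ring.
  - lra.
  - replace (z0 + 0 * (z - z0) - z0)%C with (RtoC 0) by ring. rewrite Cmod_0. lra.
  - replace (z0 + 1 * (z - z0) - z0)%C with (z - z0)%C by ring. exact Hzr.
Qed.

(** * Means of V on circles *)

(** The point of argument [theta] on the circle of radius [r]. *)
Definition circ (r theta : R) : C := (r * cos theta, r * sin theta).

Lemma circ_scal s r theta : (RtoC s * circ r theta)%C = circ (s * r) theta.
Proof. unfold circ, Cmult, RtoC; simpl. f_equal; ring. Qed.

Lemma Cmod_circ r theta : Cmod (circ r theta) = Rabs r.
Proof.
  unfold Cmod, circ; simpl fst; simpl snd.
  replace ((r * cos theta) ^ 2 + (r * sin theta) ^ 2) with (Rsqr r).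
  - apply sqrt_Rsqr_abs.
  - assert (H := sin2_cos2 theta). unfold Rsqr in *.
    replace ((r * cos theta) ^ 2 + (r * sin theta) ^ 2) with
      (r * r * (sin theta * sin theta + cos theta * cos theta)) by ring.
    rewrite H. ring.
Qed.

Lemma unit_disc_circ r theta : 0 <= r < 1 -> unit_disc (circ r theta).
Proof. intros Hr. unfold unit_disc. rewrite Cmod_circ, Rabs_pos_eq; lra. Qed.

Lemma continuous_circ_2d phi r s theta : analytic_disc phi -> 0 <= s * r < 1 ->
  continuity_2d_pt (fun s theta => Cmod (phi (circ (s * r) theta))) s theta.
Proof.
  intros Hphi Hs. apply continuity_2d_pt_filterlim.
  apply (@continuous_Cmod_comp (prod_UniformSpace R_UniformSpace R_UniformSpace)
    (fun z : R * R => phi (circ (fst z * r) (snd z))) (s, theta)).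
  apply (@continuous_comp (prod_UniformSpace R_UniformSpace R_UniformSpace)
    C_UniformSpace C_UniformSpace (fun z : R * R => circ (fst z * r) (snd z)) phi).
  - assert (H1 : continuous (fun z : R * R => fst z * r) (s, theta)).
    { apply (continuous_mult (K := R_AbsRing)).
      - apply continuous_fst.
      - apply continuous_const. }
    assert (H2 : continuous (fun z : R * R => snd z) (s, theta)) by apply continuous_snd.
    apply continuous_C_pair; simpl; apply (continuous_mult (K := R_AbsRing)); try exact H1.
    + apply (continuous_comp (fun z : R * R => snd z) cos); [exact H2|apply continuous_cos].
    + apply (continuous_comp (fun z : R * R => snd z) sin); [exact H2|apply continuous_sin].
  - apply analytic_continuous; [exact Hphi|]. now apply unit_disc_circ.
Qed.

Lemma continuous_circ phi r theta : analytic_disc phi -> 0 <= r < 1 ->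
  continuous (fun theta => Cmod (phi (circ r theta))) theta.
Proof.
  intros Hphi Hr.
  apply (continuous_Cmod_comp (fun theta => phi (circ r theta))).
  apply (continuous_comp (fun theta => circ r theta) phi).
  - apply continuous_C_pair; simpl;
      apply (continuous_scal_r (V := R_NormedModule) r);
      [apply continuous_cos|apply continuous_sin].
  - apply analytic_continuous; [exact Hphi|]. now apply unit_disc_circ.
Qed.

(** A right Riemann sum with [N + 1] equal steps dominates the integral up to the
    oscillation [e] of [h] at the scale of the step. *)
Lemma riemann_sum_ge (h : R -> R) (e d : R) (N : nat) :
  (forall s, 0 <= s <= 1 -> continuous h s) ->
  (forall s t, 0 <= s <= 1 -> 0 <= t <= 1 -> Rabs (s - t) < d -> Rabs (h s - h t) < e) ->
  / INR (S N) < d ->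
  RInt h 0 1 <= sum_f_R0 (fun j => h (INR (S j) / INR (S N)) / INR (S N)) N + e.
Proof.
  intros Hc Hu Hd.
  assert (HN : 0 < INR (S N)) by (apply lt_0_INR; lia).
  assert (HNi : 0 < / INR (S N)) by now apply Rinv_0_lt_compat.
  set (x := fun j => INR j / INR (S N)).
  assert (Hx : forall j, (j <= S N)%nat -> 0 <= x j <= 1).
  { intros j Hj. unfold x. split; [apply Rdiv_le_0_compat; [apply pos_INR|lra]|].
    apply (proj1 (Rdiv_le_1 (INR j) (INR (S N)) HN)). now apply le_INR. }
  assert (Hx0 : x O = 0) by (unfold x; change (INR 0) with 0; field; lra).
  assert (Hxs : forall j, x (S j) - x j = / INR (S N)).
  { intros j. unfold x. rewrite (S_INR j). field. lra. }
  assert (Hex : forall a b, 0 <= a <= b -> b <= 1 -> ex_RInt h a b).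
  { intros a b Hab Hb. apply (ex_RInt_continuous (V := R_CompleteNormedModule)).
    rewrite Rmin_left, Rmax_right by lra. intros z Hz. apply Hc; lra. }
  assert (Hpiece : forall j, (j <= N)%nat ->
    RInt h (x j) (x (S j)) <= (h (x (S j)) + e) / INR (S N)).
  { intros j Hj. assert (H1 := Hx j ltac:(lia)). assert (H2 := Hx (S j) ltac:(lia)).
    assert (H3 := Hxs j).
    replace ((h (x (S j)) + e) / INR (S N)) with
      (RInt (fun _ => h (x (S j)) + e) (x j) (x (S j))).
    - apply RInt_le; [lra|apply Hex; lra|apply ex_RInt_const|].
      intros s Hs.
      assert (H4 : Rabs (h s - h (x (S j))) < e).
      { apply Hu; try lra. apply Rabs_def1; lra. }
      apply Rabs_def2 in H4. lra.
    - rewrite RInt_const, H3. unfold scal; simpl; unfold mult; simpl. unfold Rdiv. ring. }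
  assert (Hsum : forall k, (k <= N)%nat ->
    RInt h 0 (x (S k)) <= sum_f_R0 (fun j => (h (x (S j)) + e) / INR (S N)) k).
  { induction k as [|k IH]; intros Hk.
    - simpl sum_f_R0. rewrite <- (Hx0 : x O = 0) at 1.
      apply Hpiece; lia.
    - assert (H1 := Hx (S k) ltac:(lia)). assert (H2 := Hx (S (S k)) ltac:(lia)).
      assert (H3 := Hxs (S k)).
      rewrite <- (RInt_Chasles (V := R_CompleteNormedModule) h 0 (x (S k)) (x (S (S k))))
        by (apply Hex; lra).
      rewrite tech5. apply Rplus_le_compat; [apply IH; lia|apply Hpiece; lia]. }
  specialize (Hsum N (le_n _)).
  replace (x (S N)) with 1 in Hsum by (unfold x; field; lra).
  eapply Rle_trans; [exact Hsum|]. apply Req_le.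
  rewrite (sum_eq _ (fun j => h (x (S j)) / INR (S N) + e / INR (S N)))
    by (intros; unfold Rdiv; ring).
  rewrite sum_plus. f_equal. rewrite sum_cte. field. lra.
Qed.

Lemma Cmod_V_le phi r theta : analytic_disc phi -> 0 <= r < 1 ->
  Cmod (V phi (circ r theta)) <=
    RInt (fun s => r * Cmod (phi (circ (s * r) theta))) 0 1.
Proof.
  intros Hphi Hr.
  assert (HV := is_RInt_V phi (circ r theta) Hphi (unit_disc_circ r theta Hr)).
  rewrite <- Cmod_norm_R.
  refine (@norm_RInt_le C_R_NormedModule _ _ 0 1 _ _ Rle_0_1 _ HV _).
  - intros s Hs. rewrite Cmod_norm_R, Cmod_mult, Cmod_circ, circ_scal, Rabs_pos_eq by lra.
    apply Rle_refl.
  - apply (@RInt_correct R_CompleteNormedModule).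
    apply (@ex_RInt_continuous R_CompleteNormedModule).
    rewrite Rmin_left, Rmax_right by lra. intros s Hs.
    apply (continuous_scal_r (V := R_NormedModule) r).
    apply (continuous_Cmod_comp (fun s => phi (circ (s * r) theta))).
    apply (continuous_comp (fun s => circ (s * r) theta) phi).
    + apply continuous_ext with (fun s => RtoC 0 + RtoC s * circ r theta)%C.
      { intros t. now rewrite circ_scal, Cplus_0_l. }
      apply continuous_line.
    + apply analytic_continuous; [exact Hphi|]. apply unit_disc_circ. nra.
Qed.

(** The gain of one power of [r] and of the factor [1 / (m + 1)].  The strict
    positivity of [A] is needed to apply Minkowski to the terms of the Riemann sum. *)
Lemma pmean_le_V p phi A m : 1 <= p -> 0 < A -> analytic_disc phi ->
  (forall r, 0 < r < 1 -> pmean_le p (fun t => Cmod (phi (circ r t))) (A * r ^ m)) ->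
  forall r, 0 < r < 1 ->
    pmean_le p (fun t => Cmod (V phi (circ r t))) (A / INR (S m) * r ^ S m).
Proof.
  intros Hp HA Hphi HM r Hr.
  assert (HS : 0 < INR (S m)) by (apply lt_0_INR; lia).
  set (c := A / INR (S m) * r ^ S m).
  assert (Hc : 0 < c).
  { apply Rmult_lt_0_compat; [now apply Rdiv_lt_0_compat|apply pow_lt; lra]. }
  apply pmean_le_limit; [lra|lra|]. intros e He.
  assert (H2d : forall s t, 0 <= s <= 1 -> 0 <= t <= 2 * PI ->
     continuity_2d_pt (fun s t => Cmod (phi (circ (s * r) t))) s t).
  { intros s t Hs _. apply continuous_circ_2d; [exact Hphi|nra]. }
  destruct (uniform_continuity_2d _ 0 1 0 (2 * PI) H2d (mkposreal (e / 2) ltac:(lra)))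
    as [d Hd]. simpl in Hd.
  assert (Hpow : continuous (fun x => c * x ^ S m) 1).
  { apply (ex_derive_continuous (V := R_NormedModule)). auto_derive. auto. }
  destruct (proj1 (filterlim_locally _ _) Hpow (mkposreal (e / 2) ltac:(lra)))
    as [d' Hd'].
  assert (Hdd : 0 < Rmin d d') by (apply Rmin_glb_lt; apply cond_pos).
  (* The step [1 / (N + 1)] is below [d], for the Riemann sum of [phi], and below
     [d'], so that [c (1 + 1 / (N + 1))^(m + 1)], which bounds the sum of the
     [B j], is within [e / 2] of [c]. *)
  destruct (archimed_cor1 _ Hdd) as ([|N] & HN & HN0); [lia|]. clear HN0.
  assert (HNd : / INR (S N) < d) by (eapply Rlt_le_trans; [exact HN|apply Rmin_l]).
  assert (HNd' : / INR (S N) < d') by (eapply Rlt_le_trans; [exact HN|apply Rmin_r]).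
  assert (HNp : 0 < INR (S N)) by (apply lt_0_INR; lia).
  assert (HNi : 0 < / INR (S N)) by now apply Rinv_0_lt_compat.
  set (x := fun j => INR (S j) / INR (S N)).
  assert (Hx : forall j, (j <= N)%nat -> 0 < x j <= 1).
  { intros j Hj. unfold x. split; [apply Rdiv_lt_0_compat; [apply lt_0_INR; lia|lra]|].
    apply (proj1 (Rdiv_le_1 (INR (S j)) (INR (S N)) HNp)). apply le_INR; lia. }
  set (h := fun (j : nat) t => r / INR (S N) * Cmod (phi (circ (x j * r) t))).
  set (B := fun j => r / INR (S N) * (A * (x j * r) ^ m)).
  assert (HB : forall j, (j <= N)%nat -> 0 < B j /\ pmean_le p (h j) (B j)).
  { intros j Hj. specialize (Hx j Hj).
    assert (Hxr : 0 < x j * r < 1) by nra.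
    assert (0 < r / INR (S N)) by (apply Rdiv_lt_0_compat; lra).
    assert (0 < A * (x j * r) ^ m)
      by (apply Rmult_lt_0_compat; [lra|apply pow_lt; lra]).
    split; [now apply Rmult_lt_0_compat|].
    apply pmean_le_scal; [lra|lra|lra|]. now apply HM. }
  assert (HsumB : 0 < sum_f_R0 B N) by (apply tech1; intros j Hj; now apply HB).
  assert (Hsum : sum_f_R0 B N <= c + e / 2).
  { rewrite (sum_eq _ (fun j => INR (S j) ^ m * (A * r ^ S m / INR (S N) ^ S m))).
    2:{ intros j Hj. unfold B, x. rewrite Rpow_mult_distr. unfold Rdiv.
        rewrite Rpow_mult_distr, pow_inv, <- !tech_pow_Rmult. field.
        split; [apply pow_nonzero|]; lra. }
    rewrite <- scal_sum.
    assert (H := sum_pow_le m N).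
    specialize (Hd' (1 + / INR (S N))).
    assert (Hb : ball 1 d' (1 + / INR (S N))).
    { change (Rabs (1 + / INR (S N) - 1) < d'). rewrite Rabs_pos_eq; lra. }
    specialize (Hd' Hb). change (Rabs (c * (1 + / INR (S N)) ^ S m - c * 1 ^ S m) < e / 2) in Hd'.
    rewrite pow1 in Hd'. apply Rabs_def2 in Hd'.
    apply Rle_trans with (c * (1 + / INR (S N)) ^ S m); [|lra].
    replace (1 + / INR (S N)) with (INR (S (S N)) * / INR (S N))
      by (rewrite (S_INR (S N)); field; lra).
    rewrite Rpow_mult_distr, pow_inv.
    assert (Hk : 0 <= A * r ^ S m / INR (S N) ^ S m / INR (S m)).
    { apply Rdiv_le_0_compat; [|lra]. apply Rdiv_le_0_compat; [|apply pow_lt; lra].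
      apply Rmult_le_pos; [lra|apply pow_le; lra]. }
    apply (Rmult_le_compat_l _ _ _ Hk) in H.
    assert (HNS : INR (S N) ^ S m <> 0) by (apply pow_nonzero; lra).
    eapply Rle_trans; [|eapply Rle_trans; [exact H|]]; apply Req_le; unfold c;
      field; split; lra. }
  apply pmean_le_mono with (fun t => sum_f_R0 (fun j => h j t) N + r * (e / 2))
    (sum_f_R0 B N + r * (e / 2)).
  - lra.
  - nra.
  - intros t. apply continuous_circ; [now apply analytic_V|lra].
  - intros t. apply Cmod_ge_0.
  - intros t Ht. eapply Rle_trans; [apply Cmod_V_le; [exact Hphi|lra]|].
    assert (H := riemann_sum_ge (fun s => Cmod (phi (circ (s * r) t))) (e / 2) d N).
    assert (Hcont : forall s, 0 <= s <= 1 ->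
       continuous (fun s => Cmod (phi (circ (s * r) t))) s).
    { intros s Hs. apply filterlim_locally. intros eps.
      destruct (H2d s t Hs Ht eps) as [dl Hdl].
      exists dl. intros y Hy. apply Hdl; [exact Hy|].
      rewrite Rminus_diag, Rabs_R0. apply cond_pos. }
    specialize (H Hcont).
    rewrite (RInt_scal (V := R_CompleteNormedModule)).
    2:{ apply (ex_RInt_continuous (V := R_CompleteNormedModule)).
        rewrite Rmin_left, Rmax_right by lra. exact Hcont. }
    change (r * RInt (fun s => Cmod (phi (circ (s * r) t))) 0 1 <=
      sum_f_R0 (fun j => h j t) N + r * (e / 2)).
    rewrite (sum_eq _ (fun j => Cmod (phi (circ (x j * r) t)) / INR (S N) * r))
      by (intros; unfold h; field; lra).
    rewrite <- scal_sum, <- Rmult_plus_distr_l.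
    apply Rmult_le_compat_l; [lra|]. apply H; [|exact HNd].
    intros s s' Hs Hs' Hss. apply Hd; try lra.
    rewrite Rminus_diag, Rabs_R0. apply cond_pos.
  - apply pmean_le_plus; [lra|exact HsumB|nra| |].
    + now apply pmean_le_sum.
    + apply pmean_le_const. nra.
Qed.

(** * Hardy norms of the powers of V *)

Lemma circle_mean_circ p f r : circle_mean p f r =
  rpow (/ (2 * PI) * RInt (fun t => rpow (Cmod (f (circ r t))) p) 0 (2 * PI)) (/ p).
Proof. reflexivity. Qed.

Lemma circle_mean_ge_0 p f r : 0 <= circle_mean p f r.
Proof. apply rpow_ge_0. Qed.

Lemma pmean_le_circle_mean p f r B : 1 <= p -> 0 <= B -> analytic_disc f ->
  0 <= r < 1 ->
  pmean_le p (fun t => Cmod (f (circ r t))) B <-> circle_mean p f r <= B.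
Proof.
  intros Hp HB Hf Hr. apply pmean_le_root; try assumption.
  - intros t. now apply continuous_circ.
  - intros t. apply Cmod_ge_0.
Qed.

Lemma circle_mean_const p f r c : 1 <= p -> 0 <= c ->
  (forall t, Cmod (f (circ r t)) = c) -> circle_mean p f r = c.
Proof.
  intros Hp Hc Hf. assert (HPI := PI_RGT_0).
  rewrite circle_mean_circ.
  rewrite (RInt_ext _ (fun _ => rpow c p)) by (intros t _; now rewrite Hf).
  rewrite RInt_const. unfold scal; simpl; unfold mult; simpl.
  replace (/ (2 * PI) * ((2 * PI - 0) * rpow c p)) with (rpow c p) by (field; lra).
  apply rpow_inv_r; lra.
Qed.

Lemma circle_mean_le_Hp_norm p f r : 0 < r < 1 ->
  Rbar_le (circle_mean p f r) (Hp_norm p f).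
Proof. intros Hr. apply (proj1 (Lub_Rbar_correct _)). now exists r. Qed.

Lemma Hp_norm_le p f (B : Rbar) :
  (forall r, 0 < r < 1 -> Rbar_le (circle_mean p f r) B) -> Rbar_le (Hp_norm p f) B.
Proof.
  intros H. apply (proj2 (Lub_Rbar_correct _)). intros x (r & Hr & ->). now apply H.
Qed.

Lemma Hp_norm_finite p f : Hp p f -> exists N, 0 <= N /\ Hp_norm p f = Finite N.
Proof.
  intros [_ H].
  assert (H1 := circle_mean_le_Hp_norm p f (1 / 2) ltac:(lra)).
  assert (H2 := circle_mean_ge_0 p f (1 / 2)).
  destruct (Hp_norm p f) as [N| |]; simpl in *; try tauto.
  exists N. split; [lra|reflexivity].
Qed.

Lemma analytic_Vpow k f : analytic_disc f -> analytic_disc (Vpow k f).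
Proof.
  intros Hf. induction k as [|k IH]; [exact Hf|]. now apply (analytic_V (Vpow k f)).
Qed.

Lemma INR_fact_pos k : 0 < INR (fact k).
Proof. apply lt_0_INR, lt_O_fact. Qed.

Lemma pmean_le_Vpow p f A k : 1 <= p -> 0 < A -> analytic_disc f ->
  (forall r, 0 < r < 1 -> pmean_le p (fun t => Cmod (f (circ r t))) A) ->
  forall r, 0 < r < 1 ->
    pmean_le p (fun t => Cmod (Vpow k f (circ r t))) (A / INR (fact k) * r ^ k).
Proof.
  intros Hp HA Hf HM. induction k as [|k IH].
  - intros r Hr. simpl. replace (A / 1 * 1) with A by field. now apply HM.
  - intros r Hr.
    assert (Hk := INR_fact_pos k).
    assert (HS : 0 < INR (S k)) by (apply lt_0_INR; lia).
    rewrite fact_simpl, mult_INR.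
    replace (A / (INR (S k) * INR (fact k))) with (A / INR (fact k) / INR (S k))
      by (field; lra).
    apply (pmean_le_V p (Vpow k f)); try assumption.
    + now apply Rdiv_lt_0_compat.
    + now apply analytic_Vpow.
Qed.

Lemma Hp_norm_Vpow p f N k : 1 <= p -> Hp p f -> Hp_norm p f = Finite N ->
  Rbar_le (Hp_norm p (Vpow k f)) (/ INR (fact k) * N).
Proof.
  intros Hp0 Hf HN. assert (Hk := INR_fact_pos k).
  assert (Hki : 0 < / INR (fact k)) by now apply Rinv_0_lt_compat.
  destruct (Hp_norm_finite p f Hf) as (N' & HN0 & E).
  assert (N' = N) by congruence. subst N'.
  apply Hp_norm_le. intros r Hr. simpl.
  apply Rle_plus_epsilon. intros e He.
  (* [N] may vanish, while [pmean_le_Vpow] wants a positive bound. *)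
  set (A := N + e * INR (fact k)).
  assert (HeK : 0 < e * INR (fact k)) by now apply Rmult_lt_0_compat.
  assert (HA : 0 < A) by (unfold A; lra).
  assert (HM : forall r, 0 < r < 1 -> pmean_le p (fun t => Cmod (f (circ r t))) A).
  { intros r' Hr'. apply pmean_le_circle_mean; [exact Hp0|lra|apply Hf|lra|].
    assert (H := circle_mean_le_Hp_norm p f r' Hr'). rewrite HN in H. simpl in H.
    unfold A. lra. }
  assert (HV := pmean_le_Vpow p f A k Hp0 HA (proj1 Hf) HM r Hr).
  assert (Hrk : 0 < r ^ k <= 1).
  { split; [apply pow_lt; lra|]. rewrite <- (pow1 k). apply pow_incr; lra. }
  assert (HAk : 0 < A / INR (fact k)) by now apply Rdiv_lt_0_compat.
  apply pmean_le_circle_mean in HV;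
    [|exact Hp0|apply Rmult_le_pos; lra|apply analytic_Vpow, Hf|lra].
  eapply Rle_trans; [exact HV|].
  replace (/ INR (fact k) * N + e) with (A / INR (fact k) * 1)
    by (unfold A; field; lra).
  apply Rmult_le_compat_l; lra.
Qed.

Lemma Hp_Vpow p f k : 1 <= p -> Hp p f -> Hp p (Vpow k f).
Proof.
  intros Hp0 Hf. split; [apply analytic_Vpow, Hf|].
  destruct (Hp_norm_finite p f Hf) as (N & HN0 & E).
  eapply Rbar_le_lt_trans; [apply (Hp_norm_Vpow p f N k Hp0 Hf E)|exact I].
Qed.

(** * Operator norms *)

Lemma Hp_opnorm_le p T (B : Rbar) :
  (forall f, Hp p f -> Rbar_le (Hp_norm p f) 1 -> Rbar_le (Hp_norm p (T f)) B) ->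
  Rbar_le (Hp_opnorm p T) B.
Proof.
  intros H. apply (proj2 (Lub_Rbar_correct _)). intros x (f & Hf & Hf1 & Hx).
  eapply Rbar_le_trans; [exact Hx|now apply H].
Qed.

(** Finiteness of the norm of [T f] matters: the supremum runs over real numbers. *)
Lemma Hp_norm_le_opnorm p T f : Hp p f -> Rbar_le (Hp_norm p f) 1 -> Hp p (T f) ->
  Rbar_le (Hp_norm p (T f)) (Hp_opnorm p T).
Proof.
  intros Hf Hf1 HT. destruct (Hp_norm_finite p (T f) HT) as (N & _ & E).
  rewrite E. apply (proj1 (Lub_Rbar_correct _)). exists f.
  rewrite E. repeat split; try apply Hf; auto. apply Rle_refl.
Qed.

Lemma Hp_one p : 1 <= p -> Hp p (fun _ => 1) /\ Hp_norm p (fun _ => 1) = Finite 1.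
Proof.
  intros Hp0.
  assert (Hcm : forall r, circle_mean p (fun _ => 1) r = 1).
  { intros r. apply circle_mean_const; [exact Hp0|lra|]. intros t. apply Cmod_1. }
  assert (E : Hp_norm p (fun _ => 1) = Finite 1).
  { apply Rbar_le_antisym.
    - apply Hp_norm_le. intros r Hr. rewrite Hcm. apply Rle_refl.
    - eapply Rbar_le_trans; [|apply (circle_mean_le_Hp_norm p _ (1 / 2)); lra].
      rewrite Hcm. apply Rle_refl. }
  split; [|exact E]. split; [|rewrite E; exact I].
  intros z0 _. exists (fun n => match n with O => RtoC 1 | _ => RtoC 0 end), 1.
  split; [lra|]. intros z _. apply is_pseries_C_psum. intros e He. exists O.
  intros n _.
  assert (Hps : psum (fun n => match n with O => RtoC 1 | _ => RtoC 0 end) n (z - z0) = 1).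
  { induction n as [|n IH]; [reflexivity|]. simpl psum. rewrite IH. ring. }
  rewrite Hps. replace (1 - 1)%C with (RtoC 0) by ring. rewrite Cmod_0. exact He.
Qed.

Lemma Vpow_one k z : unit_disc z -> Vpow k (fun _ => 1) z = (z ^ k / INR (fact k))%C.
Proof.
  assert (Ha := proj1 (proj1 (Hp_one 1 (Rle_refl 1)))).
  revert z. induction k as [|k IH]; intros z Hz.
  - simpl. field.
  - change (Vpow (S k) (fun _ => 1)) with (V (Vpow k (fun _ => 1))).
    assert (HV := is_RInt_V (Vpow k (fun _ => 1)) z (analytic_Vpow k _ Ha) Hz).
    apply (@is_RInt_unique C_R_CompleteNormedModule) in HV. rewrite <- HV. clear HV.
    apply (@is_RInt_unique C_R_CompleteNormedModule).
    set (df := fun s : R => (z * ((0 + s * z) ^ k / INR (fact k)))%C).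
    apply (@is_RInt_ext C_R_NormedModule df).
    { intros s Hs. rewrite Rmin_left, Rmax_right in Hs by lra. unfold df.
      rewrite Cplus_0_l. rewrite IH; [reflexivity|].
      apply unit_disc_ray; [lra|exact Hz]. }
    assert (Hfk : RtoC (INR (fact k)) <> 0).
    { intros H. apply RtoC_inj in H. assert (H' := INR_fact_pos k). lra. }
    assert (HSk := INR_S_neq_0 k).
    assert (HI := is_RInt_cder
      (fun s : R => ((0 + s * z) ^ S k * / INR (fact (S k)))%C) df 0 1).
    replace (z ^ S k / INR (fact (S k)))%C with
      ((0 + 1 * z) ^ S k * / INR (fact (S k)) - (0 + 0 * z) ^ S k * / INR (fact (S k)))%C.
    2:{ replace (0 + 1 * z)%C with z by ring. replace (0 + 0 * z)%C with (RtoC 0) by ring.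
        rewrite (Cpow_S 0). unfold Cdiv. ring. }
    apply HI.
    + intros s. unfold df.
      replace (z * ((0 + s * z) ^ k / INR (fact k)))%C with
        (INR (S k) * (0 + s * z) ^ k * z * / INR (fact (S k)) + (0 + s * z) ^ S k * 0)%C.
      2:{ rewrite fact_simpl, mult_INR, RtoC_mult. field. split; assumption. }
      apply (cder_mult (fun s : R => (0 + s * z) ^ S k)%C).
      * apply (cder_pow (fun s : R => 0 + s * z)%C), cder_line.
      * apply cder_const.
    + intros s. unfold df. apply (continuous_C_mult (fun _ => z)); [apply continuous_const|].
      apply (continuous_C_mult (fun s : R => (0 + s * z) ^ k)%C).
      * apply continuous_C_pow, continuous_line.
      * apply continuous_const.
Qed.

(** The means of [z^k / k!] tend to [1 / k!] as [r] tends to [1]. *)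
Lemma Hp_norm_Vpow_one p k : 1 <= p ->
  Rbar_le (/ INR (fact k)) (Hp_norm p (Vpow k (fun _ => 1))).
Proof.
  intros Hp0. destruct (Hp_one p Hp0) as [H1 _]. assert (Hk := INR_fact_pos k).
  assert (Hki : 0 < / INR (fact k)) by now apply Rinv_0_lt_compat.
  destruct (Hp_norm_finite p _ (Hp_Vpow p _ k Hp0 H1)) as (N & HN0 & E).
  rewrite E. simpl.
  assert (Hr : forall r, 0 < r < 1 -> / INR (fact k) * r ^ k <= N).
  { intros r Hr. assert (H := circle_mean_le_Hp_norm p (Vpow k (fun _ => 1)) r Hr).
    rewrite E in H. simpl in H. rewrite (circle_mean_const _ _ _ (/ INR (fact k) * r ^ k)) in H.
    - exact H.
    - exact Hp0.
    - apply Rmult_le_pos; [lra|apply pow_le; lra].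
    - intros t. rewrite Vpow_one by (apply unit_disc_circ; lra).
      unfold Cdiv. rewrite Cmod_mult, Cmod_pow, Cmod_circ, <- RtoC_inv, Cmod_R,
        !Rabs_pos_eq by lra. ring. }
  apply Rle_plus_epsilon. intros e He.
  assert (Hpow : continuous (fun x => / INR (fact k) * x ^ k) 1).
  { apply (ex_derive_continuous (V := R_NormedModule)). auto_derive. auto. }
  destruct (proj1 (filterlim_locally _ _) Hpow (mkposreal e He)) as [d Hd].
  assert (Hdp := cond_pos d).
  set (q := Rmin (d / 2) (1 / 2)).
  assert (Hq : 0 < q) by (apply Rmin_glb_lt; lra).
  assert (Hq1 : q <= d / 2) by apply Rmin_l. assert (Hq2 : q <= 1 / 2) by apply Rmin_r.
  assert (Hb : ball 1 d (1 - q)).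
  { change (Rabs (1 - q - 1) < d). apply Rabs_def1; lra. }
  specialize (Hd _ Hb).
  change (Rabs (/ INR (fact k) * (1 - q) ^ k - / INR (fact k) * 1 ^ k) < e) in Hd.
  rewrite pow1 in Hd. apply Rabs_def2 in Hd.
  specialize (Hr (1 - q) ltac:(lra)). lra.
Qed.

Lemma bounded_Hp_Vpow p k : 1 <= p -> bounded_Hp p (Vpow k).
Proof.
  intros Hp0. split; [intros f; now apply Hp_Vpow|].
  exists (/ INR (fact k)). intros f Hf.
  destruct (Hp_norm_finite p f Hf) as (N & _ & E). rewrite E.
  now apply Hp_norm_Vpow.
Qed.

(** The operator norm of the powers of [V], attained at the constant [1]. *)
Lemma Hp_opnorm_Vpow p k : 1 <= p -> Hp_opnorm p (Vpow k) = Finite (/ INR (fact k)).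
Proof.
  intros Hp0. assert (Hk := INR_fact_pos k).
  assert (Hki : 0 < / INR (fact k)) by now apply Rinv_0_lt_compat.
  apply Rbar_le_antisym.
  - apply Hp_opnorm_le. intros f Hf Hf1.
    destruct (Hp_norm_finite p f Hf) as (N & _ & E). rewrite E in Hf1. simpl in Hf1.
    eapply Rbar_le_trans; [now apply (Hp_norm_Vpow p f N)|]. simpl. nra.
  - destruct (Hp_one p Hp0) as [H1 E].
    eapply Rbar_le_trans; [exact (Hp_norm_Vpow_one p k Hp0)|].
    refine (Hp_norm_le_opnorm p (Vpow k) (fun _ => 1) H1 _ (Hp_Vpow p _ k Hp0 H1)).
    rewrite E. apply Rle_refl.
Qed.

Lemma Vpow_comp_bounded p k T : 1 <= p -> bounded_Hp p T ->
  bounded_Hp p (fun f => Vpow k (T f)).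
Proof.
  intros Hp0 [HT [M HM]]. split; [intros f Hf; apply Hp_Vpow; auto|].
  assert (Hki : 0 < / INR (fact k)) by apply Rinv_0_lt_compat, INR_fact_pos.
  exists (/ INR (fact k) * M). intros f Hf. specialize (HM f Hf).
  destruct (Hp_norm_finite p f Hf) as (N & _ & E). rewrite E in *.
  destruct (Hp_norm_finite p _ (HT f Hf)) as (N1 & _ & E1). rewrite E1 in HM. simpl in HM.
  eapply Rbar_le_trans; [now apply (Hp_norm_Vpow p (T f) N1); auto|]. simpl. nra.
Qed.

Lemma Hp_opnorm_Vpow_comp p k T : 1 <= p -> bounded_Hp p T ->
  Rbar_le (Hp_opnorm p (fun f => Vpow k (T f)))
          (Rbar_mult (/ INR (fact k)) (Hp_opnorm p T)).
Proof.
  intros Hp0 [HT _].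
  assert (Hki : 0 < / INR (fact k)) by apply Rinv_0_lt_compat, INR_fact_pos.
  apply Hp_opnorm_le. intros f Hf Hf1.
  assert (H := Hp_norm_le_opnorm p T f Hf Hf1 (HT f Hf)).
  destruct (Hp_norm_finite p _ (HT f Hf)) as (N1 & _ & E1). rewrite E1 in H.
  eapply Rbar_le_trans; [now apply (Hp_norm_Vpow p (T f) N1); auto|].
  destruct (Hp_opnorm p T) as [o| |]; simpl in H.
  - simpl. apply Rmult_le_compat_l; lra.
  - rewrite Rbar_mult_comm, (is_Rbar_mult_unique p_infty (/ INR (fact k)) p_infty); [exact I|].
    apply is_Rbar_mult_p_infty_pos. exact Hki.
  - contradiction.
Qed.

Lemma Tgn_factorization g n : (1 <= n)%nat ->
  Tgn g n = fun f => Vpow (n - 1) (Tgn g 1 f).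
Proof.
  intros Hn. destruct n as [|k]; [lia|]. rewrite Nat.sub_succ, Nat.sub_0_r.
  apply functional_extensionality. intros f. apply Nat.iter_succ_r.
Qed.

Theorem lemma2p2 (p : R) (n : nat) (g : C -> C)
  (hp : 1 <= p) (hn : (1 <= n)%nat)
  (hg : analytic_disc g) (hT : bounded_Hp p (Tgn g 1)) :
  (bounded_Hp p (Tgn g n) /\
   Rbar_le (Hp_opnorm p (Tgn g n))
           (Rbar_mult (/ INR (fact (n - 1))) (Hp_opnorm p (Tgn g 1)))) /\
  (* the factorization and the bound that submultiplicativity gives *)
  ((forall (f : C -> C) (z : C), Hp p f -> unit_disc z ->
      Tgn g n f z = Vpow (n - 1) (Tgn g 1 f) z) /\
   Rbar_le (Hp_opnorm p (Tgn g n))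
           (Rbar_mult (Hp_opnorm p (Vpow (n - 1))) (Hp_opnorm p (Tgn g 1)))) /\
  (* optimality of 1 / (n - 1)! *)
  (Hp_opnorm p (Vpow (n - 1)) = Finite (/ INR (fact (n - 1))) /\
   factorization_constant p n (/ INR (fact (n - 1))) /\
   forall c : R, factorization_constant p n c -> / INR (fact (n - 1)) <= c).
Proof.
  assert (E := Tgn_factorization g n hn).
  assert (HV := Hp_opnorm_Vpow p (n - 1) hp).
  assert (Hc := Hp_opnorm_Vpow_comp p (n - 1) (Tgn g 1) hp hT).
  rewrite E, HV. split; [split; [now apply Vpow_comp_bounded|exact Hc]|].
  split; [split; [reflexivity|exact Hc]|].
  split; [reflexivity|split].
  - split; [now apply bounded_Hp_Vpow|]. rewrite HV. apply Rle_refl.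
  - intros c [_ H]. rewrite HV in H. exact H.
Qed.
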